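(* Consider the Markov decision process described in the context: state space $\mathcal{X}$, action spaces $A(\mathbf{x}) = \{\mathbf{y}\in\mathcal{X} : \mathbf{y}\subset\mathbf{x}\}$ for $\mathbf{x}\in\mathcal{X}$, reward function $r(\mathbf{x},\mathbf{a}) = R\sum_{(x,m)\in\mathbf{x}\setminus\mathbf{a}} m$ with $R>0$, and birth-death-growth dynamics based on independent deaths with probability $p_d\in(0,1)$, a Poisson birth process on $W$ with intensity $\beta>0$ marked independently according to a probability measure $\nu$ on $[0,K]$, $K>0$, and the logistic growth function with parameter $\lambda>0$. Let $0\le\alpha<1$ and $n\in\mathbb{N}$. Then the optimal $\alpha$-discounted total expected reward over the finite horizon of $n$ steps, started in $\mathbf{x}\in\mathcal{X}$, is $$ v_n(\mathbf{x}) = R\beta|W|\sum_{k=1}^{n-1}\alpha^k\int_0^K s_{n-k}(m)\,d\nu(m) + R\sum_{(x,m)\in\mathbf{x}} s_n(m), $$ where, for $1\le k\le n$, $$ s_k(m)=\max\left\{m,\ \alpha(1-p_d)g^{(1)}(m),\ \dots,\ \alpha^{k-1}(1-p_d)^{k-1}g^{(k-1)}(m)\right\}. $$ Moreover, French thinning is an optimal policy: with $$ d_j=\max\left\{0,\ K\frac{\alpha(1-p_d)-e^{-\lambda}}{1-e^{-\lambda}},\ \dots,\ K\frac{\alpha^{j-1}(1-p_d)^{j-1}-e^{-(j-1)\lambda}}{1-e^{-(j-1)\lambda}}\right\},\qquad j\in\mathbb{N} $$ (so $d_1=0$), the deterministic Markov policy that, when $j$ steps remain (i.e. at decision epoch $i=n-j$,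 $j=n,n-1,\dots,1$), removes exactly the points of the current state with mark at least $d_j$ attains $v_n(\mathbf{x})$ for every $\mathbf{x}\in\mathcal{X}$.
   Context: Notation: $\mathbb{N}=\{1,2,\dots\}$, $\mathbb{N}_0=\{0,1,2,\dots\}$; empty sums are $0$; $0^0=1$. $W\subset\mathbb{R}^2$ is compact with area $|W|$, and $K>0$. The state space $\mathcal{X}$ is the set of finite simple marked point patterns $\mathbf{x}$ on $W$ with marks in $[0,K]$, i.e. finite sets of pairs $(x,m)$ with $x\in W$, $m\in[0,K]$ and distinct locations; it is equipped with the Borel $\sigma$-algebra of the weak topology (and is Polish). In state $\mathbf{x}$ an action is a subset $\mathbf{a}\subset\mathbf{x}$ of retained points; all subsets are allowed. Logistic growth: for $n\in\mathbb{N}_0$ and $m_0\in(0,K]$, $g^{(n)}(m_0) = K/\left(1+\left(\frac{K}{m_0}-1\right)e^{-\lambda n}\right)$ with $\lambda>0$, and $g^{(n)}(0)=0$ by convention. Dynamics: when action $\mathbf{a}$ is taken in state $\mathbf{x}$, the next state is obtained as follows. (1) Delete $\mathbf{x}\setminus\mathbf{a}$. (2) Independently of other points, each $(x,m)\in\mathbf{a}$ dies (is removed) with probability $p_d\in(0,1)$ and otherwise becomes $(x,g^{(1)}(m))$. (3) Add a (homogeneous) Poisson process on $W$ with intensity $\beta>0$, independent of the rest, whose points are marked independently according to a probability measure $\nu$ on $[0,K]$. Policies: write $(X_i,Y_i)_{i\ge0}$ for the successive states and actions. A (randomised, history dependent) policy $\phi=(\phi_i)_{i\ge0}$ is a sequence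 of conditional probability kernels $\phi_i(\cdot\mid X_0,Y_0,\dots,X_{i-1},Y_{i-1},X_i)$ generating $Y_i$, with $\phi_i(A(\mathbf{x}_i)\mid\mathbf{x}_0,\mathbf{a}_0,\dots,\mathbf{x}_i)=1$; it is deterministic Markov if $Y_i=\phi_i(X_i)$ is a function of $X_i$. The optimal $\alpha$-discounted total expected reward over $n$ steps started in $\mathbf{x}$ is $$\sup_\phi \mathbb{E}^\phi\left[\sum_{i=0}^{n-1}\alpha^i\,R\sum_{(x,m)\in X_i\setminus Y_i} m\,\Big|\,X_0=\mathbf{x}\right].$$ Equivalently it is given by the dynamic programming recursion $v_0\equiv0$, $v_n(\mathbf{x})=\max_{\mathbf{a}\subset\mathbf{x}}\{R\sum_{(x,m)\in\mathbf{x}\setminus\mathbf{a}}m+\alpha\,\mathbb{E}[v_{n-1}(X)\mid\mathbf{x},\mathbf{a}]\}$, with $X$ the next state from $\mathbf{x}$ under action $\mathbf{a}$. *)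

(* Defs.v *)
From HB Require Import structures.
From mathcomp Require Import all_boot all_order all_algebra finmap.
From mathcomp Require Import all_classical all_reals all_analysis.

Set Implicit Arguments.
Unset Strict Implicit.
Unset Printing Implicit Defensive.

Import Order.TTheory GRing.Theory Num.Theory.
Import numFieldNormedType.Exports.

Local Open Scope classical_set_scope.
Local Open Scope ring_scope.

(* Lebesgue measure lives on [measurableTypeR R], a copy of [R] carrying the   *)
(* Borel sigma-algebra; [plane R] and [mpoint R] are convertible to [R * R]   *)
(* and [R * R * R], on which the topology is taken.                           *)
Definition plane (R : realType) : Type :=
  (measurableTypeR R * measurableTypeR R)%type.
HB.instance Definition _ (R : realType) :=
  Measurable.copy (plane R) (measurableTypeR R * measurableTypeR R)%type.

Section plane.
Context {R : realType}.

Definition area : {measure set (plane R) -> \bar R} :=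
  (@lebesgue_measure R \x @lebesgue_measure R)%E.

Lemma open_measurable_plane (A : set (R * R)) :
  open A -> measurable (A : set (plane R)).
Proof.
move=> oA.
pose I := (rat * rat * nat)%type.
pose sq (t : I) : set (plane R) :=
  (ball (ratr t.1.1 : R) t.2.+1%:R^-1 : set (measurableTypeR R)) `*`
  (ball (ratr t.1.2 : R) t.2.+1%:R^-1 : set (measurableTypeR R)).
have -> : A = \bigcup_t (if `[< sq t `<=` A >] then sq t else set0).
  apply/seteqP; split=> [[x y] Axy|z [t _]]; last first.
    by case: ifPn => // /asboolP; apply.
  have /nbhs_ballP[e /= e0 eA] : nbhs (x, y) A by exact: open_nbhs_nbhs.
  have [k] : exists k : nat, (k.+1%:R^-1 : R) < e / 2.
    have [k _ ke] := near_infty_natSinv_lt (PosNum (divr_gt0 e0 (ltr0n R 2))).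
    by exists k; exact: (ke k (leqnn k)).
  move=> k2; have ke : k.+1%:R^-1 + k.+1%:R^-1 < e by rewrite [ltRHS]splitr ltrD.
  have rb (z : R) : exists q : rat, ball (ratr q : R) k.+1%:R^-1 z.
    have k0 : 0 < (k.+1%:R^-1 : R) by rewrite invr_gt0.
    have lt_z : z - k.+1%:R^-1 < z + k.+1%:R^-1 by rewrite ltrD2l gtrN.
    have [q zq] := rat_in_itvoo lt_z.
    by exists q; apply: ball_sym; rewrite ball_itv.
  have [p px] := rb x; have [q qy] := rb y.
  exists (p, q, k) => //; case: ifPn => [_|/asboolPn[]]; first by split.
  move=> [u v] [/= pu qv]; apply: eA; split => /=.
    by apply: (le_ball (ltW ke)); apply: ball_triangle pu; exact: ball_sym.
  by apply: (le_ball (ltW ke)); apply: ball_triangle qv; exact: ball_sym.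
apply: countable_bigcupT_measurable => [|t]; first exact: countableP.
by case: ifPn => // _; apply: measurableX; rewrite ball_itv; exact: measurable_itv.
Qed.

Lemma compact_measurable_plane (W : set (R * R)) :
  compact W -> measurable (W : set (plane R)).
Proof.
move=> cW; rewrite -[W]setCK; apply: measurableC; apply: open_measurable_plane.
by apply: closed_openC; apply: compact_closed => //; exact: norm_hausdorff.
Qed.

End plane.

Definition mpoint (R : realType) : Type := (plane R * measurableTypeR R)%type.
HB.instance Definition _ (R : realType) :=
  Measurable.copy (mpoint R) (plane R * measurableTypeR R)%type.

Section iid.
Context d (T : measurableType d) (R : realType).

Definition tuple_cons k (p : T * k.-tuple T) : k.+1.-tuple T :=
  [tuple of p.1 :: p.2].

Lemma measurable_tuple_cons k : measurable_fun [set: _] (@tuple_cons k).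
Proof. exact: measurable_cons. Qed.

HB.instance Definition _ k :=
  isMeasurableFun.Build _ _ _ _ (@tuple_cons k) (@measurable_tuple_cons k).

Fixpoint iid (P : probability T R) (k : nat) : probability (k.-tuple T) R :=
  match k with
  | 0 => \d_([tuple] : 0.-tuple T)
  | k'.+1 => distribution (P \x iid P k')%E (@tuple_cons k')
  end.

End iid.

Section patterns.
Context {R : realType}.
Variables (W : set (R * R)) (K : R).

(* A point ((x1, x2), m) has location (x1, x2) and mark m.                     *)
Definition is_pattern (x : {fset R * R * R}) : Prop :=
  (forall p, p \in x -> W p.1 /\ 0 <= p.2 <= K) /\
  {in x &, injective (fun p : R * R * R => p.1)}.

Record pattern := Pattern {
  points :> {fset R * R * R} ;
  patternP : `[< is_pattern points >] }.

HB.instance Definition _ := [isSub for points].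
HB.instance Definition _ := [Choice of pattern by <:].

Lemma sub_is_pattern (y x : {fset R * R * R}) :
  (y `<=` x)%fset -> is_pattern x -> is_pattern y.
Proof.
move=> /fsubsetP yx [xWK xinj]; split=> [p /yx /xWK//|p q /yx px /yx qx].
exact: xinj.
Qed.

Lemma fset0_is_pattern : is_pattern fset0.
Proof. by split. Qed.

HB.instance Definition _ :=
  isPointed.Build pattern (Pattern (asboolT fset0_is_pattern)).

(* The weak topology is the coarsest one for which x |-> \sum_(p in x) f p is  *)
(* continuous for every continuous f : W * [0, K] -> R.                        *)
Definition test_function :=
  {f : R * R * R -> R | {within W `*` [set` `[0, K]], continuous f}}.

Definition weak_embedding (x : pattern) : prod_topology (fun _ : test_function => R) :=
  fun f => \sum_(p <- points x) sval f p.

HB.instance Definition _ :=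
  Topological.copy pattern (initial_topology weak_embedding).

Definition state : Type := g_sigma_algebraType (@open pattern).
HB.instance Definition _ :=
  Measurable.copy state (g_sigma_algebraType (@open pattern)).

(* An action is given by the retained points, so this is the action that       *)
(* removes exactly the points of mark at least d.                              *)
Definition thinned (d : R) (x : pattern) : {fset R * R * R} :=
  [fset p in points x | p.2 < d]%fset.

Lemma thinned_is_pattern d x : `[< is_pattern (thinned d x) >].
Proof.
apply/asboolP; apply: sub_is_pattern (asboolW (patternP x)).
by apply/fsubsetP => p; rewrite !inE => /andP[].
Qed.

Definition french_thinning (d : R) (x : state) : state :=
  Pattern (thinned_is_pattern d x).

End patterns.

Section forest.
Context {R : realType}.
Variables (W : set (R * R)) (cW : compact W) (K : R).
Variables (nu : probability (measurableTypeR R) R).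
Variables (lambda beta pd c alpha : R).

Local Notation state := (state W K).
Local Notation leb2 := (@area R).

(* Division by zero is zero here, so mark 0 needs its own case.                *)
Definition logistic (n : nat) (m : R) : R :=
  if m == 0 then 0 else K / (1 + (K / m - 1) * expR (- (lambda * n%:R))).

Definition grown (s : {fset R * R * R}) : {fset R * R * R} :=
  [fset (p.1, logistic 1 p.2) | p in s]%fset.

(* [mnormalize] returns its second argument on the zero measure: that value is *)
(* irrelevant, as there are no births when W is a null set.                    *)
Definition uniform_on_W : probability (plane R) R :=
  mnormalize (mrestr leb2 (compact_measurable_plane cW)) (\d_(point : plane R)).

Definition newborn : probability (mpoint R) R := (uniform_on_W \x nu)%E.

(* Poisson probability of k births. [poisson_pmf] is not used because it is    *)
(* identically 1 at rate 0.                                                    *)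
Definition birth_count_pmf (k : nat) : R :=
  let rate := beta * fine (leb2 W) in expR (- rate) * rate ^+ k / k`!%:R.

(* [transition a]: the law of the next state when a is retained. s is the set  *)
(* of survivors and t lists the newborn points. Configurations with coinciding *)
(* locations have probability zero: newborn points are drawn only if W has     *)
(* positive area, and their locations are then uniform on W.                   *)
Definition transition (a : state) : set state -> \bar R := fun B =>
  (\sum_(s <- fpowerset (points a))
     ((1 - pd) ^+ #|` s| * pd ^+ #|` (points a `\` s)%fset|)%R%:E *
     \sum_(0 <= k <oo) (birth_count_pmf k)%:E *
       iid newborn k [set t | exists2 y : state, B y &
         points y = (grown s `|` [fset p in (t : seq (R * R * R))])%fset])%E.

(* The history at epoch i consists of the past pairs (X_j, Y_j), j < i, and of *)
(* the current state X_i.                                                      *)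
Definition policy : Type :=
  forall i : nat, R.-pker (i.-tuple (state * state) * state) ~> state.

Definition admissible (phi : policy) : Prop :=
  forall i (h : i.-tuple (state * state)) (x : state),
    phi i (h, x) [set a : state | (points a `<=` points x)%fset] = 1%E.

Definition reward (x a : state) : R :=
  c * \sum_(p <- (points x `\` points a)%fset) p.2.

Definition discounted_reward (h : seq (state * state)) : R :=
  \sum_(i < size h) alpha ^+ i * reward (nth point h i).1 (nth point h i).2.

(* The law of (X_0, Y_0, X_1, Y_1, ...) under phi, given X_0 = x, is           *)
(*   phi_0(dy_0 | x) transition(y_0)(dx_1) phi_1(dy_1 | x, y_0, x_1) ...,      *)
(* and the expectation of a function F of (X_j, Y_j)_(j < i + n), given the    *)
(* history (h, x) at epoch i, is the corresponding iterated integral (the one  *)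
(* over x_(i + n), on which F does not depend, is harmless).                   *)
Fixpoint expectation_from (phi : policy) (F : seq (state * state) -> \bar R)
    (n i : nat) (h : i.-tuple (state * state)) (x : state) : \bar R :=
  match n with
  | 0 => F h
  | n'.+1 => (\int[phi i (h, x)]_a \int[transition a]_y
       expectation_from phi F n' [tuple of rcons h (x, a)] y)%E
  end.

Definition expected_reward (phi : policy) (n : nat) (x : state) : \bar R :=
  expectation_from phi (fun h => (discounted_reward h)%:E) n [tuple] x.

Definition optimal_reward (n : nat) (x : state) : \bar R :=
  ereal_sup [set expected_reward phi n x | phi in admissible].

(* The term j = 0 of the maximum is m, and that of the next one is 0.          *)
Definition best_harvest (k : nat) (m : R) : R :=
  \big[Num.max/m]_(1 <= j < k)
    (alpha ^+ j * (1 - pd) ^+ j * logistic j m).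

Definition threshold (j : nat) : R :=
  \big[Num.max/0]_(1 <= i < j)
    (K * ((alpha ^+ i * (1 - pd) ^+ i - expR (- (i%:R * lambda))) /
          (1 - expR (- (i%:R * lambda))))).

End forest.

(* Main.v *)
Require Import Defs.
From HB Require Import structures.
From mathcomp Require Import all_boot all_order all_algebra finmap.
From mathcomp Require Import all_classical all_reals all_analysis.
From mathcomp Require Import measurable_realfun ring lra.

Set Implicit Arguments.
Unset Strict Implicit.
Unset Printing Implicit Defensive.

Import Order.TTheory GRing.Theory Num.Theory.
Import numFieldNormedType.Exports.

Local Open Scope classical_set_scope.
Local Open Scope ring_scope.

(* With j steps left, the claimed value is affine in the point pattern: it is *)
(* a constant plus the sum of harvest_j over the marks, where                 *)
(* harvest_(j+1)(m) = max(m, alpha (1 - pd) harvest_j(g(m))). The expectation *)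
(* under the transition law of a sum over points is again such a sum, by      *)
(* linearity over independent survivals and Poisson births, so the Bellman    *)
(* maximum splits into one choice per point; for m > 0 the second term is     *)
(* strictly larger exactly when m < d_(j+1). Expectations are compared by     *)
(* monotonicity of the integral alone, which avoids measurability of the      *)
(* iterated integrands.                                                       *)
(* The remaining work is to see the transition law as a measure on the Borel  *)
(* sets of the weak topology: those are generated by the hitting sets         *)
(* { x : x meets O }, O open, because finitely many disjoint rational balls,  *)
(* each hit exactly once, form a base.                                        *)

(** Points do not interact, so the optimal value is additive. A point kept for j steps is worth, in
    expectation and per unit of [c], [(alpha * (1 - pd)) ^+ j] times its grown mark, and the best
    choice of j depends on that point alone. The one-point recursion [harvest] is solved by
    [harvestE], using the semigroup law [logistic_logistic]. Clearing denominators in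
    [lt_threshold_term] turns each comparison of removing now with waiting i steps into a linear
    inequality in the mark; this gives the thresholds through [harvest_threshold].

    By [integral_transition], the mean of an affine additive functional of the next state is again
    affine and additive in the retained pattern. Hence [valueSE] writes the gap between the claimed
    value and the value of an action as a sum of one-point gaps: all are nonnegative, and all vanish
    for thinning at the threshold. Induction on the remaining horizon, uniformly in the history,
    extends this to policies: [expectation_le_value] bounds every admissible policy from above, and
    [expectation_ge_value] bounds French thinning from below.

    Since [transition] is a bare set function, [transition_measure] first identifies it on Borel
    sets with a mixture of images of iid samples. For this the map from samples to patterns must be
    Borel ([measurable_birth], through [measurable_fun_hit]), and samples must almost surely have no
    coinciding locations ([iid_fresh]). *)

Section raw_integral.
Context d (T : measurableType d) (R : realType).
Import HBNNSimple.
Local Open Scope ereal_scope.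
Implicit Types (f : T -> \bar R).

(** The integral is built from simple functions, which evaluate the set function on measurable sets
    only. So [transition] may be replaced by a measure that agrees with it there. *)
Lemma eq_integral_setfun (m1 m2 : set T -> \bar R) f :
  (forall B, measurable B -> m1 B = m2 B) ->
  \int[m1]_x f x = \int[m2]_x f x.
Proof.
move=> m12; rewrite /integral.
have E (h : {nnsfun T >-> R}) : sintegral m1 h = sintegral m2 h.
  rewrite /sintegral; apply: eq_fsbigr => r _; rewrite m12//.
by congr (ereal_sup _ - ereal_sup _); apply/seteqP; split=> _ [h /= hf <-];
  exists h.
Qed.

(** Every simple function below [f1] is below [f2], so the suprema compare whether or not the
    functions are measurable. *)
Lemma ge0_le_integral_raw (m : {measure set T -> \bar R}) f1 f2 :
  (forall x, 0 <= f1 x) -> (forall x, f1 x <= f2 x) ->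
  \int[m]_x f1 x <= \int[m]_x f2 x.
Proof.
move=> f10 f12; have f20 x : 0 <= f2 x by apply: le_trans (f12 x).
rewrite !ge0_integralTE//; apply: le_ereal_sup => _ [h /= hf <-].
by exists h => //= x; apply: le_trans (f12 x).
Qed.

Lemma ge0_integral_wsum (I : Type) (l : seq I) (w : I -> R)
    (m : I -> {measure set T -> \bar R}) : (forall i, (0 <= w i)%R) ->
  exists mu : {measure set T -> \bar R},
    (forall B, mu B = \sum_(i <- l) (w i)%:E * m i B) /\
    (forall f, (forall x, 0 <= f x) -> measurable_fun setT f ->
      \int[mu]_x f x = \sum_(i <- l) (w i)%:E * \int[m i]_x f x).
Proof.
move=> w0; pose z : {measure set T -> \bar R} := mzero.
pose s i : {measure set T -> \bar R} := mscale (NngNum (w0 i)) (m i).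
exists (msum (nth z (map s l)) (size (map s l))); split=> [B|f f0 mf].
  by rewrite /= /msum -(big_mkord xpredT (fun j => nth z (map s l) j B))
    -(big_nth z xpredT (fun mu : {measure set T -> \bar R} => mu B)) big_map.
rewrite ge0_integral_measure_sum//.
rewrite -(big_mkord xpredT (fun j => \int[nth z (map s l) j]_x f x)).
rewrite -(big_nth z xpredT (fun mu : {measure set T ->
  \bar R} => \int[mu]_x f x)).
by rewrite big_map; apply: eq_bigr => i _; rewrite ge0_integral_mscale.
Qed.

Lemma ge0_integral_wseries (w : nat -> R)
    (m : nat -> {measure set T -> \bar R}) : (forall i, (0 <= w i)%R) ->
  exists mu : {measure set T -> \bar R},
    (forall B, mu B = \sum_(0 <= i <oo) (w i)%:E * m i B) /\
    (forall f, (forall x, 0 <= f x) -> measurable_fun setT f ->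
      \int[mu]_x f x = \sum_(0 <= i <oo) (w i)%:E * \int[m i]_x f x).
Proof.
move=> w0; exists (mseries (fun i => mscale (NngNum (w0 i)) (m i)) 0%N).
split=> // f f0 mf; rewrite ge0_integral_measure_series//.
by apply: eq_eseriesr => i _; rewrite ge0_integral_mscale.
Qed.

End raw_integral.

(** * The weak topology on patterns *)

Section initial_cvg.

Lemma cvg_initial_topology (S : choiceType) (T : topologicalType) (f : S -> T)
    (F : set_system S) (x : S) : Filter F ->
  f @ F --> f x -> F --> (x : initial_topology f).
Proof.
move=> FF fF U /=; rewrite /= (@nbhsE (initial_topology f)).
case=> B [[C oC <-] Cfx] /filterS; apply; apply: fF.
by rewrite nbhsE; exists C.
Qed.

End initial_cvg.

Lemma seq_uniform_gt0 (R : realFieldType) (T : eqType) (s : seq T)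
    (P : T -> R -> Prop) :
  (forall p e e', P p e -> e' <= e -> P p e') ->
  (forall p, p \in s -> exists2 e, 0 < e & P p e) ->
  exists2 e, 0 < e & forall p, p \in s -> P p e.
Proof.
move=> Pmon; elim: s => [|p s IH] Ps; first by exists 1.
have [|e e0 eP] := IH; first by move=> q qs; apply: Ps; rewrite inE qs orbT.
have [|d d0 dP] := Ps p; first by rewrite mem_head.
exists (Num.min d e); first by rewrite lt_min d0.
move=> q; rewrite inE => /predU1P[->|/eP].
  by apply: Pmon dP _; rewrite ge_min lexx.
by move=> /Pmon; apply; rewrite ge_min lexx orbT.
Qed.

Section pattern_topology.
Context {R : realType}.
Variables (W : set (R * R)) (K : R).
Local Notation pattern := (pattern W K).
Local Notation space := (W `*` [set` `[0, K]]).
Implicit Types (x y : pattern) (f : R * R * R -> R).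

Lemma cvg_pattern (F : set_system pattern) x : Filter F ->
  (forall f, {within space, continuous f} ->
    (fun y : pattern => \sum_(p <- points y) f p) @ F --> \sum_(p <- points x)
      f p) ->
  F --> x.
Proof.
move=> FF cF.
apply: (@cvg_initial_topology _ _ (@weak_embedding R W K)).
apply/cvg_sup => f.
apply: cvg_initial_topology.
exact: (cF (sval f) (svalP f)).
Qed.

Lemma continuous_sum_points f : {within space, continuous f} ->
  continuous (fun y : pattern => \sum_(p <- points y) f p).
Proof.
move=> cf y.
pose g : test_function W K := exist _ f cf.
have c := @initial_continuous _ _ (@weak_embedding R W K) y.
have FF := @fmap_filter _ _ (@weak_embedding R W K) _ (nbhs_filter y).
have h := (iffLR (cvg_sup _ _ FF)) c g.
have h2 := @initial_continuous _ _
  (fun h : prod_topology (fun _ : test_function W K => R) => h g)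
  (@weak_embedding R W K y).
exact: cvg_comp h h2.
Qed.

Definition hit (O : set (R * R * R)) : set pattern :=
  [set x | exists2 p, p \in points x & O p].

Lemma pattern_in x p : p \in points x -> space p.
Proof. by move=> px; have /asboolP[/(_ p px)[]] := patternP x. Qed.

Lemma pattern_inj x : {in points x &, injective fst}.
Proof. by have /asboolP[] := patternP x. Qed.

(** A tent function positive at the hit point and zero off [O] turns hitting into positivity of a
    weakly continuous sum. *)
Lemma open_hit (O : set (R * R * R)) : open O -> open (hit O).
Proof.
move=> oO; rewrite openE => x [p px Op].
have /nbhs_ballP[e /= e0 eO] : nbhs p O by exact: open_nbhs_nbhs.
pose h q := 1 - `|q - p| / e.
(* twice the positive part of [h], a tent at [p] *)
pose f q := `|h q| + h q.
have ch : continuous h.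
  move=> q; apply: cvgB; first exact: cvg_cst.
  apply: cvgMr_tmp; apply: cvg_norm; apply: cvgB;
    [exact: cvg_id|exact: cvg_cst].
have cf : continuous f by move=> q; apply: cvgD; [apply: cvg_norm|]; exact: ch.
have f0 q : 0 <= f q by rewrite -lerBlDr sub0r ler_normr lexx orbT.
have fO q : O q \/ f q = 0.
  have [h0|h0] := ltP 0 (h q); [left|right].
    apply: eO; move: h0; rewrite subr_gt0 ltr_pdivrMr// mul1r => qe.
    by rewrite -ball_normE /ball_/= distrC.
  by rewrite /f ler0_norm// addNr.
have := @continuous_sum_points f (continuous_subspaceT cf) x.
move=> /(_ [set r | 0 < r]) /= h1.
have : nbhs x [set y : pattern | 0 < \sum_(p <- points y) f p].
  apply: h1; apply: open_nbhs_nbhs; split; first exact: open_gt.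
  rewrite /= (big_fsetD1 p)//= ltr_wpDr ?sumr_ge0//.
  by rewrite /f /h subrr normr0 mul0r subr0 normr1 addr_gt0.
apply: filterS => y /= y0.
apply: contrapT => noP.
have /negP[] : ~~ (0 < \sum_(p <- points y) f p); last by [].
rewrite -leNgt big_seq big1// => q qy; case: (fO q) => // Oq.
by case: noP; exists q.
Qed.


(** The filter generated by the small injective perturbations of [x] converges to [x], because a
    test function varies little near each of finitely many points. *)
Lemma nbhs_pattern x (U : set pattern) : nbhs x U ->
  exists2 e : R, 0 < e & forall y (g : R * R * R -> R * R * R),
    {in points x &, injective g} ->
    points y = [fset g p | p in points x]%fset ->
    (forall p, p \in points x -> ball p e (g p)) -> U y.
Proof.
pose A e y := exists g : R * R * R -> R * R * R,
  [/\ {in points x &, injective g},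
      points y = [fset g p | p in points x]%fset &
      forall p, p \in points x -> ball p e (g p)].
pose F : set_system pattern := filter_from [set e : R | 0 < e] A.
have FF : Filter F.
  apply: filter_from_filter => [|i j /= i0 j0]; first by exists 1 => /=.
  exists (Num.min i j) => /=; first by rewrite lt_min i0.
  move=> y [g [gi gE gb]]; split; exists g; split=> // p /gb.
    by apply: le_ball; rewrite ge_min lexx.
  by apply: le_ball; rewrite ge_min lexx orbT.
suff Fx : F --> x.
  move=> /Fx[e /= e0 eU]; exists e => // y g gi gE gb.
  by apply: eU; exists g.
apply: cvg_pattern => f cf.
apply/cvgrPdist_lt => eps eps0.
pose N : nat := size (points x).
(* Dividing by one more than the number of points keeps the final bound strict and covers the empty
   pattern. *)
have eN : 0 < eps / N.+1%:R by rewrite divr_gt0.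
have [e e0 eP] : exists2 e, 0 < e & forall p, p \in points x ->
    forall q, space q -> ball p e q -> `|f p - f q| < eps / N.+1%:R.
  apply: seq_uniform_gt0 => [p d d' + d'd|p px].
    by move=> h q sq /(le_ball d'd); exact: h.
  have /subspace_continuousP/(_ p (pattern_in px)) := cf.
  move=> /cvgrPdist_lt/(_ _ eN); rewrite near_withinE.
  by move=> /nbhs_ballP[d /= d0 dP]; exists d => // q sq /dP; exact.
exists e => //= y [g [gi gE gb]].
rewrite gE big_imfset//= -sumrB.
apply: le_lt_trans (ler_norm_sum _ _ _) _.
apply: (@le_lt_trans _ _ (\sum_(p <- points x) eps / N.+1%:R)).
  rewrite big_seq [leRHS]big_seq; apply: ler_sum => p px.
  apply: ltW; apply: eP => //; last exact: gb.
  by apply: (@pattern_in y); rewrite gE; apply/imfsetP; exists p.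
rewrite big_const_seq count_predT iter_addr_0 -/N -[_ *+ N]mulr_natr.
by rewrite mulrAC ltr_pdivrMr// ltr_pM2l// ltr_nat.
Qed.

End pattern_topology.

(** * Hitting sets generate the Borel sets *)

Section hitting_sets.
Context {R : realType}.
Variables (W : set (R * R)) (K : R).
Local Notation pattern := (pattern W K).
Local Notation state := (state W K).
Local Notation point := (R * R * R)%type.
Implicit Types (x y : pattern).

Definition ball_index := (rat * rat * rat * nat)%type.

Definition rational_ball (i : ball_index) : set point :=
  ball ((ratr i.1.1.1, ratr i.1.1.2, ratr i.1.2) : R * R * R) i.2.+1%:R^-1.

Lemma open_rational_ball i : open (rational_ball i).
Proof. exact: ball_open. Qed.

Lemma rational_ball_nbhs (p : point) (e : R) : 0 < e ->
  exists i, rational_ball i p /\ rational_ball i `<=` ball p e.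
Proof.
move=> e0; have [k] : exists k : nat, (k.+1%:R^-1 : R) < e / 2.
  have [k _ ke] := near_infty_natSinv_lt (PosNum (divr_gt0 e0 (ltr0n R 2))).
  by exists k; exact: (ke k (leqnn k)).
move=> k2; have ke : k.+1%:R^-1 + k.+1%:R^-1 < e by rewrite [ltRHS]splitr ltrD.
have rb (z : R) : exists q : rat, ball (ratr q : R) k.+1%:R^-1 z.
  have k0 : 0 < (k.+1%:R^-1 : R) by rewrite invr_gt0.
  have lt_z : z - k.+1%:R^-1 < z + k.+1%:R^-1 by rewrite ltrD2l gtrN.
  have [q zq] := rat_in_itvoo lt_z.
  by exists q; apply: ball_sym; rewrite ball_itv.
move: p => [[a b] c].
have [q qa] := rb a; have [r rb'] := rb b; have [s sc] := rb c.
have qrs : rational_ball (q, r, s, k) (a, b, c) by split.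
exists (q, r, s, k); split=> // y ky.
apply: (le_ball (ltW ke)); apply: ball_triangle ky; exact: ball_sym.
Qed.

Definition disjoint_balls : seq ball_index -> bool :=
  pairwise (fun i j => `[< rational_ball i `&` rational_ball j = set0 >]).

Definition hit_all (L : seq ball_index) : set pattern :=
  [set x | forall i, i \in L -> hit (rational_ball i) x].

(** Points chosen in disjoint balls are distinct. *)
Lemma size_hit_all L x : disjoint_balls L -> hit_all L x ->
  (size L <= #|` points x|)%N.
Proof.
move=> dL hL.
pose P (i : ball_index) p := p \in points x /\ rational_ball i p.
have [g gP] : {g & forall i, i \in L -> P i (g i)}.
  apply: (@choice _ _ (fun i p => i \in L -> P i p)) => i.
  have [iL|//] := boolP (i \in L); last by exists (0, 0, 0).
  by have [p px ip] := hL _ iL; exists p.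
rewrite -(size_map g); apply: uniq_leq_size; last first.
  by move=> p /mapP[i /gP[gx _] ->].
rewrite uniq_pairwise pairwise_map.
apply: (sub_in_pairwise (P := mem L)) dL; last exact/allP.
move=> i j iL jL /asboolP dij; apply/eqP => gij.
have [_ gi] := gP _ iL; have [_ gj] := gP _ jL.
by have : set0 (g i) by rewrite -dij; split=> //; rewrite gij.
Qed.

Lemma separating_balls x (e : R) : 0 < e ->
  exists b : point -> ball_index,
    [/\ forall p, p \in points x -> rational_ball (b p) p,
        forall p, p \in points x -> rational_ball (b p) `<=` ball p e,
        forall p q, p \in points x -> q \in points x -> p != q ->
          rational_ball (b p) `&` rational_ball (b q) = set0 &
        disjoint_balls (map b (points x))].
Proof.
move=> e0.
(* Distinct points are too far apart for their balls of radius [d] to meet. *)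
have [d d0 dP] : exists2 d, 0 < d & forall p, p \in points x ->
    forall q, q \in points x -> ball p (d + d) q -> q = p.
  apply: seq_uniform_gt0 => [p d d' H d'd q qx pq|p px].
    by apply: H => //; apply: le_ball pq; rewrite lerD.
  apply: seq_uniform_gt0 => [q d d' H d'd pq|q qx].
    by apply: H => //; apply: le_ball pq; rewrite lerD.
  have [->|qp] := eqVneq q p; first by exists 1.
  exists (`|p - q| / 2); first by rewrite divr_gt0// normr_gt0 subr_eq0 eq_sym.
  by rewrite -splitr -ball_normE /ball_/= ltxx.
have [b bP] : {b & forall p, rational_ball (b p) p /\
    rational_ball (b p) `<=` ball p (Num.min d e)}.
  apply: (@choice _ _ (fun p i => rational_ball i p /\
    rational_ball i `<=` ball p (Num.min d e))) => p.
  by apply: rational_ball_nbhs; rewrite lt_min d0.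
have bd p q : p \in points x -> q \in points x -> p != q ->
    rational_ball (b p) `&` rational_ball (b q) = set0.
  move=> px qx pq; apply/seteqP; split=> // r [/(bP p).2 pr /(bP q).2 qr].
  move/negP: pq; apply; rewrite eq_sym; apply/eqP; apply: dP => //.
  apply: (@ball_triangle _ _ r).
    by apply: le_ball pr; rewrite ge_min lexx.
  by apply/ball_sym; apply: le_ball qr; rewrite ge_min lexx.
exists b; split=> //.
- by move=> p _; case: (bP p).
- move=> p _ r /(bP p).2; apply: le_ball; by rewrite ge_min lexx orbT.
rewrite /disjoint_balls pairwise_map.
apply: (sub_in_pairwise (P := mem (points x)) (r := fun p q => p != q)).
- by move=> p q px qx pq; apply/asboolP; apply: bd.
- exact/allP.
- by rewrite -uniq_pairwise fset_uniq.
Qed.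

(** The second condition bounds the number of points by the size of [L], but is phrased with hitting
    sets only. *)
Definition cell (L : seq ball_index) : set pattern :=
  [set x | hit_all L x /\ forall L', size L' = (size L).+1 ->
    disjoint_balls L' -> ~ hit_all L' x].

(** With more points, separating balls around them would provide one disjoint hit ball too many. *)
Lemma cell_card L x : cell L x -> (#|` points x| <= size L)%N.
Proof.
move=> [_ noL]; rewrite leqNgt; apply/negP => Lx.
have [b [b1 _ _ b3]] := separating_balls x ltr01.
have /= := noL (take (size L).+1 (map b (points x))).
rewrite size_takel ?size_map//; apply=> //.
  by rewrite /disjoint_balls; apply: subseq_pairwise b3; exact: take_subseq.
move=> i /mem_take/mapP[p px ->]; exists p => //; exact: b1.
Qed.

(** Take small separating balls around the points of [x]. A pattern in their cell has exactly one
    point in each, so it is a small perturbation of [x] and [nbhs_pattern] applies. *)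
Lemma cell_basis x (U : set pattern) : nbhs x U ->
  exists L, [/\ disjoint_balls L, cell L x & cell L `<=` U].
Proof.
move=> /nbhs_pattern[e e0 eU].
have [b [b1 b2 b3 b4]] := separating_balls x e0.
exists (map b (points x)); split=> //.
  split=> [i /mapP[p px ->]|L' L'S dL' hL'].
    by exists p => //; exact: b1.
  by have := size_hit_all dL' hL'; rewrite L'S size_map ltnn.
move=> y [hy /= ny].
have [g gP] : {g & forall p, p \in points x ->
    g p \in points y /\ rational_ball (b p) (g p)}.
  apply: (@choice _ _ (fun p q => p \in points x ->
    q \in points y /\ rational_ball (b p) q)) => p.
  have [px|//] := boolP (p \in points x); last by exists (0, 0, 0).
  by have [|q qy bq] := hy (b p); [exact: map_f|exists q].
have gi : {in points x &, injective g}.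
  move=> p q px qx gpq; apply/eqP/negPn/negP => pq.
  suff : set0 (g p) by [].
  rewrite -(b3 p q)//; split; first by case: (gP p).
  by rewrite gpq; case: (gP q).
apply: (eU y g) => //; last by move=> p px; apply: b2 => //; case: (gP p).
apply/esym/eqP; rewrite eqEfcard; apply/andP; split.
  by apply/fsubsetP => _ /imfsetP[p /= px ->]; case: (gP p).
rewrite card_in_imfset//.
have : cell (map b (points x)) y by split.
by move=> /cell_card; rewrite size_map.
Qed.

(** There are countably many cells, each a countable Boolean combination of hitting sets, and an
    open set is the union of the cells that it contains. *)
Lemma measurable_fun_hit d (T : measurableType d) (D : set T) (h : T -> state) :
  measurable D ->
  (forall O, open O -> measurable (D `&` h @^-1` (hit (K:=K) (W:=W) O))) ->
  measurable_fun D h.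
Proof.
move=> mD mh.
have mA L : measurable (D `&` h @^-1` hit_all L).
  elim: L => [|i L IH].
    by rewrite (_ : _ @^-1` _ = setT) ?setIT//; apply/seteqP; split.
  rewrite (_ : _ `&` _ = (D `&` h @^-1` hit (rational_ball i)) `&`
      (D `&` h @^-1` hit_all L)).
    by apply: measurableI => //; apply: mh; exact: open_rational_ball.
  apply/seteqP; split=> t.
    move=> [Dt hL]; split; split=> //; first by apply: hL; rewrite mem_head.
    by move=> j jL; apply: hL; rewrite inE jL orbT.
  move=> [[Dt hi] [_ hL]]; split=> // j.
  by rewrite inE => /predU1P[->//|/hL].
refine (@measurability _ _ T state D h (@open pattern) _ _) => // _ [U oU <-].
rewrite (_ : _ `&` _ = \bigcup_(L : seq ball_index)
  (if `[< disjoint_balls L /\ cell L `<=` U >] then D `&` h @^-1` cell L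
   else set0)).
  apply: countable_bigcupT_measurable => [|L]; first exact: countableP.
  case: ifPn => // _.
  rewrite (_ : _ `&` _ = (D `&` h @^-1` hit_all L) `\`
    \bigcup_(L' : seq ball_index)
     (if (size L' == (size L).+1) && disjoint_balls L' then D `&` h @^-1`
       hit_all L'
      else set0)).
    apply: measurableD => //.
    apply: countable_bigcupT_measurable => [|L']; first exact: countableP.
    by case: ifPn.
  apply/seteqP; split=> t.
    move=> [Dt [hL nL]]; split=> // -[L' _].
    by case: ifPn => // /andP[/eqP sL' dL'] [_]; exact: nL.
  move=> [[Dt hL] nL]; split=> //; split=> // L' sL' dL' hL'.
  by apply: nL; exists L' => //; rewrite sL' eqxx dL'.
apply/seteqP; split=> t.
  move=> [Dt Ut]; have [|L [dL cL LU]] := @cell_basis (h t) U.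
    by apply: open_nbhs_nbhs.
  by exists L => //; case: ifPn => // /asboolPn[].
by move=> [L _]; case: ifPn => // /asboolP[_ LU] [Dt /LU].
Qed.

End hitting_sets.

(** * Measurable maps and sets of states *)

Section state_measurability.
Context {R : realType}.
Variables (W : set (R * R)) (K : R).
Local Notation pattern := (pattern W K).
Local Notation state := (state W K).
Local Notation space := (W `*` [set` `[0, K]]).

Lemma open_measurable_state (U : set pattern) :
  open U -> measurable (U : set state).
Proof. exact: sub_sigma_algebra. Qed.

Lemma measurable_sum_points (f : R * R * R -> R) :
  {within space, continuous f} ->
  measurable_fun [set: state] (fun x : state => \sum_(p <- points x) f p).
Proof.
move=> /continuous_sum_points cf.
apply: (measurability _ (RGenOInfty.measurableE R)) => _ [_ [a ->] <-].
rewrite setTI; apply: open_measurable_state.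
move/continuousP : cf; apply; rewrite set_itvoy; exact: open_gt.
Qed.

(** The thinned pattern hits [O] exactly when the original hits the part of [O] with marks below
    [d], which is open because retention is a strict inequality. *)
Lemma measurable_french_thinning (d : R) :
  measurable_fun setT (@french_thinning R W K d).
Proof.
apply: measurable_fun_hit => // O oO; rewrite setTI.
rewrite (_ : _ @^-1` _ = hit (O `&` [set p | p.2 < d])).
  apply: open_measurable_state; apply: open_hit; apply: openI => //.
  apply: (@open_comp _ _ (snd : R * R * R -> R) [set r | r < d]).
    by move=> p _; exact: cvg_snd.
  exact: open_lt.
apply/seteqP; split=> x [p] /=.
  by rewrite !inE => /andP[px pd] Op; exists p.
by move=> px [Op pd]; exists p => //; rewrite !inE px.
Qed.

Definition sub_states (z : {fset R * R * R}) : set state :=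
  [set a | (points a `<=` z)%fset].

Lemma measurable_sub_states z : measurable (sub_states z).
Proof.
rewrite (_ : sub_states z = ~` hit (~` [set` z])).
  apply: measurableC; apply: open_measurable_state; apply: open_hit.
  apply: closed_openC; apply: compact_closed; first exact: norm_hausdorff.
  by apply: finite_compact; exact: finite_fset.
apply/seteqP; split=> a /=.
  by move=> /fsubsetP az [p /az pz]; apply.
move=> na; apply/fsubsetP => p pa; apply: contrapT => pz; apply: na.
by exists p.
Qed.

(** Among the sub-patterns of [x], only [x] itself is not contained in [x] with one point
    deleted. *)
Lemma measurable_state1 (x : state) : measurable [set x].
Proof.
rewrite (_ : [set x] = sub_states (points x) `\`
    \big[setU/set0]_(p <- points x) sub_states (points x `\ p)%fset).
  apply: measurableD; first exact: measurable_sub_states.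
  by apply: bigsetU_measurable => p _; exact: measurable_sub_states.
rewrite -bigcup_seq; apply/seteqP; split=> a /=.
  move=> ->; split; first exact: fsubset_refl.
  move=> [p px]; rewrite /sub_states /= => /fsubsetP/(_ p px).
  by rewrite !inE eqxx.
move=> [/= ax nax]; apply/val_inj/eqP; rewrite /= eqEfsubset ax /=.
apply/fsubsetP => p px; apply: contrapT => pa; apply: nax; exists p => //.
apply/fsubsetP => q qa; rewrite !inE (fsubsetP ax)// andbT.
by apply/eqP => qp; apply: pa; rewrite -qp.
Qed.

End state_measurability.

(** * Measurability on spaces of marked points *)

Section measurable_equalities.
Context {R : realType} d (T : measurableType d).

Lemma measurable_forall_fin (I : finType) (A : I -> set T) :
  (forall i, measurable (A i)) -> measurable [set t | forall i, A i t].
Proof.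
move=> mA; rewrite (_ : [set t | _] = \bigcap_i A i).
  by apply: fin_bigcap_measurable => //; exact: finite_finset.
by apply/seteqP; split=> t /= h i => [_|]; exact: h.
Qed.

Lemma measurable_eqR (f g : T -> measurableTypeR R) :
  measurable_fun setT f -> measurable_fun setT g ->
  measurable [set t | f t = g t].
Proof.
move=> mf mg; have := measurable_fun_eqr mf mg.
move=> /(_ measurableT [set true]); rewrite setTI => h.
rewrite (_ : [set t | _] = (fun x => f x == g x) @^-1` [set true]);
  first exact: h.
by apply/seteqP; split=> t /= /eqP.
Qed.

Lemma measurable_eq_plane (f g : T -> plane R) :
  measurable_fun setT f -> measurable_fun setT g ->
  measurable [set t | f t = g t].
Proof.
move=> /measurable_fun_pairP[f1 f2] /measurable_fun_pairP[g1 g2].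
rewrite (_ : [set t | _] = [set t | (f t).1 = (g t).1] `&` [set t | (f t).2 =
  (g t).2]).
  by apply: measurableI; exact: measurable_eqR.
apply/seteqP; split=> t /=; first by move=> ->.
by case: (f t) (g t) => [? ?] [? ?] /= [-> ->].
Qed.

Lemma measurable_eq_mpoint (f g : T -> mpoint R) :
  measurable_fun setT f -> measurable_fun setT g ->
  measurable [set t | f t = g t].
Proof.
move=> /measurable_fun_pairP[f1 f2] /measurable_fun_pairP[g1 g2].
rewrite (_ : [set t | _] = [set t | (f t).1 = (g t).1] `&` [set t | (f t).2 =
  (g t).2]).
  by apply: measurableI; [exact: measurable_eq_plane|exact: measurable_eqR].
apply/seteqP; split=> t /=; first by move=> ->.
by case: (f t) (g t) => [? ?] [? ?] /= [-> ->].
Qed.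

End measurable_equalities.

Lemma open_measurable_mpoint (R : realType) (A : set (R * R * R)) :
  open A -> measurable (A : set (mpoint R)).
Proof.
move=> oA; rewrite (_ : A = \bigcup_(i : ball_index)
  if `[< rational_ball (R:=R) i `<=` A >] then rational_ball i else set0).
  apply: countable_bigcupT_measurable => [|i]; first exact: countableP.
  case: ifPn => // _; rewrite /rational_ball.
  have mb (x e : R) : measurable (ball x e : set (measurableTypeR R)).
    by rewrite ball_itv; exact: measurable_itv.
  pose b (x : R) : set (measurableTypeR R) := ball x i.2.+1%:R^-1.
  rewrite (_ : ball _ _ = ((b (ratr i.1.1.1) `*` b (ratr i.1.1.2)) `*` b (ratr
    i.1.2))).
    by apply: measurableX; [apply: measurableX|]; exact: mb.
  by apply/seteqP; split=> -[[x y] z] /= [[]].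
apply/seteqP; split=> [p Ap|p [i _]]; last by case: ifPn => // /asboolP; apply.
have /nbhs_ballP[e /= e0 eA] : nbhs p A by exact: open_nbhs_nbhs.
have [i [ip ie]] := rational_ball_nbhs p e0.
by exists i => //; case: ifPn => // /asboolPn[]; apply: subset_trans eA.
Qed.

(** * Independent samples and absence of coincidences *)

Section iid_theory.
Context d (T : measurableType d) (R : realType) (P : probability T R).
Local Open Scope ereal_scope.

Lemma iidSE k (A : set (k.+1.-tuple T)) :
  iid P k.+1 A = \int[P]_p iid P k [set t | A (tuple_cons (p, t))].
Proof.
rewrite /= /distribution /pushforward /product_measure1 /=.
apply: eq_integral => p _ /=; congr (iid P k _).
by apply/seteqP; split=> t /=; rewrite /xsection /= ?inE.
Qed.

(** Induction on the sample size: Tonelli splits off the first entry. *)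
Lemma ge0_integral_iid_sum k (f : T -> R) : measurable_fun setT f ->
  (forall p, 0 <= f p)%R ->
  \int[iid P k]_t (\sum_(p <- (t : seq T)) f p)%:E =
    k%:R%:E * \int[P]_p (f p)%:E.
Proof.
move=> mf f0; have mS n : measurable_fun setT
    (fun t : n.-tuple T => (\sum_(p <- (t : seq T)) f p)%R).
  under eq_fun do rewrite big_tuple.
  by apply: measurable_sum => i; apply: measurableT_comp (measurable_tnth i).
elim: k => [|k IH].
  rewrite mul0e; apply: integral0_eq => t _.
  by rewrite (tuple0 t) big_nil.
have mSE n : measurable_fun setT
    (fun t : n.-tuple T => (\sum_(p <- (t : seq T)) f p)%:E).
  by apply/measurable_EFinP; exact: mS.
change (\int[distribution (P \x iid P k) (@tuple_cons d T k)]_t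
  (\sum_(p <- (t : seq T)) f p)%:E = k.+1%:R%:E * \int[P]_p (f p)%:E).
rewrite ge0_integral_distribution; [|exact: mSE|]; last first.
  by move=> t; rewrite lee_fin sumr_ge0.
pose F (z : T * k.-tuple T) := (\sum_(p <- (tuple_cons z : seq T)) f p)%:E.
have mF : measurable_fun setT F.
  exact: (measurableT_comp (mSE k.+1) (@measurable_tuple_cons _ T k)).
have F0 z : 0 <= F z by rewrite lee_fin sumr_ge0.
transitivity (\int[P]_p \int[iid P k]_t F (p, t)).
  exact: (@fubini_tonelli1 _ _ _ _ _ P (iid P k) F mF F0).
have f0E p : 0 <= (f p)%:E by rewrite lee_fin.
have mfE : measurable_fun setT (fun p => (f p)%:E) by exact/measurable_EFinP.
have S0 n (t : n.-tuple T) : 0 <= (\sum_(p <- (t : seq T)) f p)%:E.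
  by rewrite lee_fin sumr_ge0.
have If0 : 0 <= \int[P]_p (f p)%:E by exact: integral_ge0.
have inner p : \int[iid P k]_t F (p, t) =
    (f p)%:E + k%:R%:E * \int[P]_p (f p)%:E.
  rewrite /F /=; under eq_integral do rewrite big_cons EFinD.
  rewrite ge0_integralD//; last exact: mSE.
  by rewrite integral_cst// [X in _ * X]probability_setT mule1 IH.
under eq_integral do rewrite inner.
rewrite ge0_integralD//; last by move=> *; rewrite mule_ge0.
rewrite integral_cst// [X in _ * X]probability_setT mule1.
rewrite -[X in X + _]mul1e -ge0_muleDl//.
by rewrite -EFinD -natr1 addrC.
Qed.

End iid_theory.

Section fresh_tuples.
Context {R : realType}.
Variables (W : set (R * R)) (cW : compact W) (K : R).
Local Notation space := (W `*` [set` `[0, K]]).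
Local Notation T := (mpoint R).

(** [L] holds the locations already taken: those of the survivors and, within inductions, those of
    the newborns already drawn. *)
Definition fresh (L : seq (R * R)) k : set (k.-tuple T) :=
  [set t | (forall i, space (tnth t i)) /\
    (forall i, forall l, l \in L -> (tnth t i).1 <> l) /\
    (forall i j, i != j -> (tnth t i).1 <> (tnth t j).1)].

Lemma measurable_space : measurable (space : set T).
Proof.
by apply: measurableX; [exact: compact_measurable_plane|exact: measurable_itv].
Qed.

Lemma measurable_tnth_fst k (i : 'I_k) :
  measurable_fun setT (fun t : k.-tuple T => (tnth t i).1).
Proof.
apply: (measurableT_comp (@measurable_fst _ _ (plane R) (measurableTypeR R))).
exact: measurable_tnth.
Qed.

Lemma measurable_tnth_space k :
  measurable [set t : k.-tuple T | forall i, space (tnth t i)].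
Proof.
apply: measurable_forall_fin => i.
by have := @measurable_tnth _ T k i measurableT _ measurable_space;
  rewrite setTI.
Qed.

Lemma measurable_fresh L k : measurable (@fresh L k).
Proof.
apply: measurableI; first exact: measurable_tnth_space.
apply: measurableI.
  apply: measurable_forall_fin => i.
  rewrite [X in measurable X](_ : _ = [set t : k.-tuple T |
      forall l : seq_sub L, (tnth t i).1 <> val l]).
    apply: measurable_forall_fin => l; apply: measurableC.
    by apply: measurable_eq_plane;
      [exact: measurable_tnth_fst|exact: measurable_cst].
  apply/seteqP; split=> t /= h l; first exact/h/valP.
  by move=> lL; exact: (h (SeqSub lL)).
apply: measurable_forall_fin => i; apply: measurable_forall_fin => j.
have [->|ij] := eqVneq i j.
  by rewrite [X in measurable X](_ : _ = setT)//; apply/seteqP; split.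
rewrite [X in measurable X](_ : _ = ~` [set t : k.-tuple T | (tnth t i).1 =
  (tnth t j).1]).
  by apply: measurableC; apply: measurable_eq_plane; exact: measurable_tnth_fst.
by apply/seteqP; split=> t /=; [move=> /(_ isT)|move=> ? _].
Qed.

Lemma fresh_cons L k p (t : k.-tuple T) :
  fresh L (tuple_cons (p, t)) <->
  [/\ space p, p.1 \notin L & fresh (p.1 :: L) t].
Proof.
have E0 : tnth (tuple_cons (p, t)) ord0 = p by exact: tnth0.
have ES i : tnth (tuple_cons (p, t)) (lift ord0 i) = tnth t i by exact: tnthS.
split=> [[sp [nL inj]]|[sp pL [st [nL inj]]]].
  split.
  - by have := sp ord0; rewrite E0.
  - by apply/negP => /(nL ord0); rewrite E0.
  split=> [i|]; first by have := sp (lift ord0 i); rewrite ES.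
  split=> [i l|i j ij]; last first.
    by have := inj (lift ord0 i) (lift ord0 j); rewrite !ES; apply.
  rewrite inE => /predU1P[->|lL].
    by have := inj (lift ord0 i) ord0; rewrite E0 ES; apply.
  by have := nL (lift ord0 i) l lL; rewrite ES.
split=> [i|]; first by case: (unliftP ord0 i) => [j ->|->]; rewrite ?ES ?E0.
split=> [i l lL|i j].
  case: (unliftP ord0 i) => [i' ->|->]; rewrite ?ES ?E0.
    by apply: nL; rewrite inE lL orbT.
  by move=> pl; move: pL; rewrite pl lL.
case: (unliftP ord0 i) => [i' ->|->]; case: (unliftP ord0 j) => [j' ->|->];
  rewrite ?ES ?E0.
- by move=> ij; apply: inj; apply: contraNneq ij => ->.
- by move=> _; apply: nL; rewrite mem_head.
- by move=> _ /esym; apply: nL; rewrite mem_head.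
- by rewrite eqxx.
Qed.

(** Draw one point at a time: it almost surely avoids the finitely many locations in [L], then joins
    the list that the others must avoid. Hence [L] varies in the induction. *)
Lemma iid_fresh (P : probability T R) :
  P space = 1%E -> (forall l : R * R, P [set p | p.1 = l] = 0%E) ->
  forall k L, iid P k (@fresh L k) = 1%E.
Proof.
move=> P1 P0; elim=> [|k IH] L.
  rewrite /= diracE mem_set//; split; first by case.
  by split=> [[]|[]].
rewrite iidSE.
pose A : set T := space `\` \big[setU/set0]_(l <- L) [set p : T | p.1 = l].
have mA1 (l : R * R) : measurable [set p : T | p.1 = l].
  by apply: measurable_eq_plane; [exact: measurable_fst|exact: measurable_cst].
have mA2 : measurable (\big[setU/set0]_(l <- L) [set p : T | p.1 = l]).
  exact: bigsetU_measurable.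
have PL : P (\big[setU/set0]_(l <- L) [set p : T | p.1 = l]) = 0%E.
  elim: L {A mA2} => [|l L IHL]; first by rewrite big_nil measure0.
  rewrite big_cons; apply: null_set_setU => //; last exact: P0.
  exact: bigsetU_measurable.
have mA : measurable A by apply: measurableD => //; exact: measurable_space.
have A1 : P A = 1%E.
  rewrite measureD//; last 2 first.
  - exact: measurable_space.
  - by rewrite [X in (X < _)%E](_ : _ = 1%E) ?ltry//; exact: P1.
  rewrite [X in (X - _)%E](_ : _ = 1%E); last exact: P1.
  rewrite [X in (_ - X)%E](_ : _ = 0%E) ?sube0//.
  apply: (@subset_measure0 _ _ _ P _ (\big[setU/set0]_(l <- L) [set p : T |
    p.1 = l])) => //.
    by apply: measurableI => //; exact: measurable_space.
transitivity (\int[P]_p (\1_A p)%:E)%E; last first.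
  by rewrite integral_indic// setIT.
apply: eq_integral => p _; rewrite indicE.
have [|nA] := boolP (p \in A).
  rewrite inE => -[sp pL]; rewrite -(IH (p.1 :: L)).
  congr (iid P k _); apply/seteqP; split=> t /=.
    by move=> /fresh_cons[].
  move=> ft; apply/fresh_cons; split=> //.
  apply/negP => pl; apply: pL; rewrite -bigcup_seq.
  by exists p.1.
rewrite (_ : [set t | _] = set0) ?measure0//.
apply/seteqP; split=> t //= /fresh_cons[sp pL _].
move/negP : nA; apply; rewrite inE; split=> //.
by rewrite -bigcup_seq => -[l /= lL pl]; move: pL; rewrite pl lL.
Qed.

End fresh_tuples.

(** * Adding newborns to the survivors *)

Section births.
Context {R : realType}.
Variables (W : set (R * R)) (cW : compact W) (K : R).
Local Notation space := (W `*` [set` `[0, K]]).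
Local Notation T := (mpoint R).
Local Notation state := (state W K).
Variables (S : {fset R * R * R}) (patS : is_pattern W K S).

Definition with_births (t : seq (R * R * R)) : {fset R * R * R} :=
  (S `|` [fset p in t])%fset.

(** Total on samples: one that does not yield a pattern is sent to the empty pattern. *)
Definition birth k (t : k.-tuple T) : state :=
  insubd (point : pattern W K) (with_births (t : seq (R * R * R))).

Local Notation config t := (with_births (t : seq (R * R * R))).

Lemma mem_with_births k (t : k.-tuple T) p :
  p \in config t <-> p \in S \/ exists i, p = tnth t i.
Proof.
rewrite in_fsetE in_fset /=; split.
  move=> /orP[pS|/(@tnthP k _ (t : k.-tuple (R * R * R)))]; first by left.
  by right.
move=> [->//|it]; apply/orP; right.
exact/(@tnthP k _ (t : k.-tuple (R * R * R))).
Qed.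

Lemma birthP k (t : k.-tuple T) :
  is_pattern W K (config t) ->
  points (birth t) = config t.
Proof. by move=> h; rewrite /birth val_insubd ifT//; exact/asboolP. Qed.

Lemma birthN k (t : k.-tuple T) :
  ~ is_pattern W K (config t) -> birth t = point.
Proof. by move=> h; apply: val_inj; rewrite val_insubd ifN//;
  exact/asboolPn. Qed.

(** A finite set forgets repetitions, so equal entries are tolerated; only distinct points with a
    common location are excluded. *)
Lemma measurable_birth_ok k :
  measurable [set t : k.-tuple T | is_pattern W K (config t)].
Proof.
rewrite [X in measurable X](_ : _ =
  [set t : k.-tuple T | forall i, space (tnth t i)] `&`
  ([set t : k.-tuple T | forall i j,
      (tnth t i).1 <> (tnth t j).1 \/ tnth t i = tnth t j] `&`
   [set t : k.-tuple T | forall i (g : S),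
      (tnth t i).1 <> (val g).1 \/ tnth t i = val g])).
  apply: measurableI; first exact: measurable_tnth_space.
  apply: measurableI; do 2 apply: measurable_forall_fin => ?;
    apply: measurableU.
  - by apply: measurableC; apply: measurable_eq_plane;
    exact: measurable_tnth_fst.
  - by apply: measurable_eq_mpoint; exact: measurable_tnth.
  - by apply: measurableC; apply: measurable_eq_plane;
    [exact: measurable_tnth_fst|exact: measurable_cst].
  - by apply: measurable_eq_mpoint;
    [exact: measurable_tnth|exact: measurable_cst].
have [SW Sinj] := patS.
apply/seteqP; split=> t /=.
  move=> [sp inj].
  have tB i : tnth t i \in config t.
    by apply/mem_with_births; right; exists i.
  have SB p : p \in S -> p \in config t.
    by move=> pS; apply/mem_with_births; left.
  split=> [i|]; first exact: (sp _ (tB i)).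
  split=> i j.
    have [e|] := pselect ((tnth t i).1 = (tnth t j).1); last by left.
    by right; apply: inj.
  have [e|] := pselect ((tnth t i).1 = (val j).1); last by left.
  by right; apply: inj => //; exact/SB/valP.
move=> [sp [inj injS]]; split=> [p|p q].
  by move=> /mem_with_births[/SW//|[i ->]]; exact: (sp i).
move=> /mem_with_births[pS|[i ->]].
  move=> /mem_with_births[qS|[j ->]] e.
    exact: Sinj.
  case: (injS j [` pS]%fset) => [/=|->//]; by rewrite -e.
move=> /mem_with_births[qS|[j ->]] e.
  by case: (injS i [` qS]%fset).
by case: (inj i j).
Qed.

(** An invalid sample gives the empty pattern, which hits nothing; a valid one hits [O] through a
    point of [S] or through an entry of the sample. *)
Lemma measurable_birth k : measurable_fun setT (@birth k).
Proof.
apply: measurable_fun_hit => // O oO; rewrite setTI.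
have mO i : measurable [set t : k.-tuple T | O (tnth t i)].
  have := @measurable_tnth _ T k i measurableT _ (open_measurable_mpoint oO).
  by rewrite setTI.
rewrite (_ : _ @^-1` _ =
   [set t : k.-tuple T | is_pattern W K (config t)] `&`
   (if `[< exists2 p, p \in S & O p >] then setT
    else ~` [set t : k.-tuple T | forall i, ~ O (tnth t i)])).
  apply: measurableI; first exact: measurable_birth_ok.
  case: ifPn => // _; apply: measurableC; apply: measurable_forall_fin => i.
  exact: measurableC (mO i).
apply/seteqP; split=> t.
  have [ok|nok] := pselect (is_pattern W K (config t)); last first.
    rewrite /preimage/= (birthN nok).
    by move=> [p pp Op]; have := in_fset0 p; rewrite [LHS]pp.
  move=> [p]; rewrite birthP//.
  move=> /mem_with_births[pS|[i ->]] Op.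
    by split => //; rewrite ifT//; apply/asboolP; exists p.
  by split => //; case: ifPn => // _ /(_ i).
move=> [ok]; case: ifPn => [/asboolP[p pS Op] _|_ /= /existsNP[i /contrapT Oi]].
  by exists p => //; rewrite birthP//; apply/mem_with_births; left.
exists (tnth t i) => //; rewrite birthP//.
by apply/mem_with_births; right; exists i.
Qed.

(** The event on the left is the one in [transition]; its witness [y] can only be [birth t]. *)
Lemma birth_setE k (B : set state) :
  [set t : k.-tuple T | exists2 y : state, B y &
     points y = config t] =
  [set t : k.-tuple T | is_pattern W K (config t)] `&`
    @birth k @^-1` B.
Proof.
apply/seteqP; split=> t /=.
  move=> [y By yE].
  have ok : is_pattern W K (config t).
    by rewrite -yE; apply/asboolP; exact: patternP.
  split => //; rewrite (_ : birth t = y)//.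
  by apply: val_inj => /=; rewrite birthP.
by move=> [ok Bt]; exists (birth t) => //; exact: birthP.
Qed.

(** The permutation lets sums over the new pattern split into survivors and newborns. *)
Lemma fresh_with_births k (t : k.-tuple T) :
  fresh W K [seq p.1 | p <- S] t ->
  is_pattern W K (config t) /\
  perm_eq (config t) (S ++ (t : seq (R * R * R))).
Proof.
move=> [sp [nL inj]]; have [SW Sinj] := patS.
have ut : uniq (t : seq (R * R * R)).
  apply/(@tuple_uniqP _ _ (t : k.-tuple (R * R * R))) => i j e;
    apply/eqP/negPn/negP => /inj; apply.
  by congr fst.
split.
  split=> [p|p q].
    by move=> /mem_with_births[/SW//|[i ->]]; exact: (sp i).
  move=> /mem_with_births[pS|[i ->]].
    move=> /mem_with_births[qS|[j ->]] e.
      exact: Sinj.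
    by case: (nL j p.1) => //; exact: map_f.
  move=> /mem_with_births[qS|[j ->]] e.
    by case: (nL i q.1) => //; exact: map_f.
  by have [->//|/inj] := eqVneq i j.
apply: uniq_perm; first exact: fset_uniq.
  rewrite cat_uniq fset_uniq ut andbT /=; apply/hasPn => p.
  move=> /(@tnthP _ _ (t : k.-tuple (R * R * R)))[i ->].
  by apply/negP => iS; apply: (nL i (tnth t i).1) => //; exact: map_f.
by move=> p; rewrite mem_cat in_fsetE in_fset.
Qed.

End births.

(** * The law of one newborn *)

Section newborn_law.
Context {R : realType}.
Variables (W : set (R * R)) (cW : compact W) (K : R).
Variables (nu : probability (measurableTypeR R) R).
Local Notation space := (W `*` [set` `[0, K]]).
Local Notation newborn := (newborn cW nu).
Local Open Scope ereal_scope.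

Lemma ge0_integral_newborn_mark (h : R -> R) :
  measurable_fun [set: measurableTypeR R] h -> (forall m, 0 <= h m)%R ->
  \int[newborn]_p (h p.2)%:E = \int[nu]_m (h m)%:E.
Proof.
move=> mh h0.
pose F (p : mpoint R) := (h p.2)%:E.
have mF : measurable_fun setT F.
  apply/measurable_EFinP.
  exact: (measurableT_comp mh (@measurable_snd _ _ (plane R) (measurableTypeR
    R))).
have F0 p : 0 <= F p by rewrite lee_fin.
transitivity (\int[uniform_on_W cW]_x \int[nu]_m F (x, m)).
  exact: (@fubini_tonelli1 _ _ _ _ _ (uniform_on_W cW) nu F mF F0).
by rewrite /F /= integral_cst// [X in _ * X]probability_setT mule1.
Qed.

Hypothesis nuK : nu [set` `[0%R, K]] = 1.
Hypothesis W_gt0 : (0 < fine (area W))%R.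

(** [mnormalize] uses its default only for total mass 0 or infinity, and [fine] sends both to 0. *)
Lemma uniform_on_WE (A : set (plane R)) : uniform_on_W cW A =
  area (A `&` W) * (fine (area W))^-1%:E.
Proof.
have WE : area ([set: plane R] `&` W) = area W by congr (area _); exact: setTI.
rewrite /uniform_on_W /= /mnormalize; case: ifPn => [W0|_].
  by case/orP: W0 => /eqP /(etrans (esym WE)) W0; move: W_gt0; rewrite W0 ltxx.
by congr (_ * (fine _)^-1%:E); exact: WE.
Qed.

Lemma newborn_space : newborn space = 1.
Proof.
have mW := compact_measurable_plane cW.
transitivity (uniform_on_W cW W * nu [set` `[0%R, K]]).
  by apply: product_measure1E => //; exact: measurable_itv.
rewrite nuK mule1 uniform_on_WE setIid.
have Wfin : area W \is a fin_num.
  rewrite fin_numE; apply/andP.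
  by split; apply/eqP => WE; move: W_gt0; rewrite WE ltxx.
by rewrite -[X in X * _]fineK// -EFinM divff// gt_eqF.
Qed.

Lemma newborn_location (l : R * R) : newborn [set p | p.1 = l] = 0.
Proof.
have m1 : measurable ([set l] : set (plane R)).
  have -> : [set l] = [set p : plane R | id p = cst (l : plane R) p] by [].
  by apply: measurable_eq_plane; [exact: measurable_id|exact: measurable_cst].
rewrite (_ : [set p | _] = [set l] `*` setT); last first.
  by apply/seteqP; split=> p //= [].
transitivity (uniform_on_W cW [set l] * nu setT).
  exact: product_measure1E.
rewrite uniform_on_WE [X in X * _ * _](_ : _ = 0) ?mul0e//.
apply: (@subset_measure0 _ _ _ area _ [set l]) => //.
  by apply: measurableI => //; exact: compact_measurable_plane.
case: l {m1} => x y.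
rewrite (_ : [set (x, y)] = [set x] `*` [set y]).
  transitivity (@lebesgue_measure R [set x] * @lebesgue_measure R [set y]).
    by apply: product_measure1E; exact: measurable_set1.
  by rewrite lebesgue_measure_set1 mul0e.
by apply/seteqP; split=> -[a b] /= [-> ->].
Qed.

End newborn_law.

(** * Mass and mean of the Poisson law, up to normalisation *)

Section poisson_sums.
Context {R : realType}.
Implicit Type r : R.
Local Open Scope ereal_scope.

Lemma exp_eseries r : (0 <= r)%R ->
  \sum_(0 <= k <oo) (r ^+ k / k`!%:R)%:E = (expR r)%:E.
Proof.
move=> r0; rewrite expRE -EFin_lim; last first.
  rewrite /pseries/=; under eq_fun do rewrite mulrC.
  exact: is_cvg_series_exp_coeff.
apply/congr_lim/funext => n/=; rewrite /pseries/= /series/= -sumEFin//.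
by under eq_bigr do rewrite mulrC.
Qed.

(** The factor k cancels against k!, so dropping the zero term and shifting the index leaves r times
    the exponential series. *)
Lemma exp_eseries_mean r : (0 <= r)%R ->
  \sum_(0 <= k <oo) (r ^+ k / k`!%:R * k%:R)%:E = (r * expR r)%:E.
Proof.
move=> r0.
have t0 k : (0 <= r ^+ k / k`!%:R :> R)%R by rewrite divr_ge0 ?exprn_ge0.
rewrite nneseries_recl// ?mulr0 ?add0e; last by move=> k;
  rewrite lee_fin mulr_ge0.
rewrite -(@nneseries_addn _ (fun k => (r ^+ k / k`!%:R * k%:R)%:E)); last first.
  by move=> k; rewrite lee_fin mulr_ge0.
rewrite EFinM -exp_eseries// -nneseriesZl; last by move=> k _; rewrite lee_fin.
apply: eq_eseriesr => k _; rewrite -EFinM addn1 factS natrM exprS; congr EFin.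
by rewrite invfM -!mulrA; congr (_ * (_ * _))%R; rewrite mulrCA mulVf ?mulr1.
Qed.

End poisson_sums.

(** * Independent survivals *)

Section random_subset.
Context {R : comNzRingType} {T : choiceType}.
Variable q : R.
Implicit Types (A s : {fset T}) (F : {fset T} -> R).

Lemma big_fpowersetU1 (V : nmodType) p A (F : {fset T} -> V) : p \notin A ->
  \sum_(s <- fpowerset (p |` A)%fset) F s =
  \sum_(s <- fpowerset A) (F s + F (p |` s)%fset).
Proof.
move=> pA; rewrite big_split /=.
rewrite (big_fsetID _ (fun s => p \notin s)) /=.
congr (_ + _).
  apply: perm_big; apply: uniq_perm; rewrite ?fset_uniq// => s.
  rewrite !inE /= !fpowersetE; apply/andP/idP => [[sA ps]|sA].
    apply/fsubsetP => x xs; have := fsubsetP sA x xs; rewrite !inE.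
    by case/orP => // /eqP xp; rewrite -xp xs in ps.
  split; first exact: fsubset_trans sA (fsubsetU1 _ _).
  by apply: contra pA => /(fsubsetP sA).
pose h (s : {fset T}) := (p |` s)%fset.
have hi : {in fpowerset A &, injective h}.
  move=> s t; rewrite !fpowersetE => sA tA /fsetP st; apply/fsetP => x.
  have := st x; rewrite !inE; have [->|//] := eqVneq x p.
  move=> _; have /negbTE -> : p \notin s by apply: contra pA => /(fsubsetP sA).
  by have /negbTE -> : p \notin t by apply: contra pA => /(fsubsetP tA).
rewrite -(@big_imfset _ _ _ _ _ imfset_key h (mem (fpowerset A)) F)//=.
apply: perm_big; apply: uniq_perm; rewrite ?fset_uniq// => s.
rewrite !inE /= fpowersetE negbK; apply/andP/imfsetP => [[sA ps]|[t /= + ->]].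
  exists (s `\ p)%fset; last by rewrite /h fsetD1K.
  rewrite /= fpowersetE; apply/fsubsetP => x; rewrite !inE => /andP[xp xs].
  by have := fsubsetP sA x xs; rewrite !inE (negbTE xp).
by rewrite fpowersetE => tA; rewrite /h fsetUS ?fset1U1.
Qed.

Definition thin_weight A s : R := (1 - q) ^+ #|` s| * q ^+ #|` (A `\` s)%fset|.

(** Conditioning on whether [p] dies. *)
Lemma sum_thin_weightU1 p A F : p \notin A ->
  \sum_(s <- fpowerset (p |` A)%fset) thin_weight (p |` A)%fset s * F s =
  \sum_(s <- fpowerset A)
    thin_weight A s * (q * F s + (1 - q) * F (p |` s)%fset).
Proof.
move=> pA; rewrite big_fpowersetU1//; rewrite big_seq [RHS]big_seq.
apply: eq_bigr => s; rewrite fpowersetE => sA.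
have ps : p \notin s by apply: contra pA => /(fsubsetP sA).
have E1 : ((p |` A) `\` s = p |` (A `\` s))%fset.
  apply/fsetP => x; rewrite !inE; have [->|] //= := eqVneq x p.
  by rewrite ps.
have E2 : ((p |` A) `\` (p |` s) = A `\` s)%fset.
  apply/fsetP => x; rewrite !inE negb_or; have [->|] //= := eqVneq x p.
  by rewrite (negbTE pA) andbF.
rewrite /thin_weight E1 E2 !cardfsU1 ps inE (negbTE pA) andbF /= !add1n !exprS.
ring.
Qed.

Lemma sum_thin_weight A : \sum_(s <- fpowerset A) thin_weight A s = 1.
Proof.
elim/finSet_rect: A => A IH; have [->|[p pA]] := fset_0Vmem A.
  rewrite fpowerset0 big_seq_fset1 /thin_weight.
  by rewrite fsetDv cardfs0 !expr0 mulr1.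
have := IH _ (fproperD1 pA); have := fsetD1K pA.
set B := (A `\ p)%fset => BA IHB.
have pB : p \notin B by rewrite !inE eqxx.
rewrite -BA; transitivity
  (\sum_(s <- fpowerset (p |` B)%fset) thin_weight (p |` B)%fset s * 1).
  by apply: eq_bigr => s _; rewrite mulr1.
rewrite (@sum_thin_weightU1 p B (fun=> 1))// -[RHS]IHB; apply: eq_bigr => s _.
ring.
Qed.

(** One more point adds [(1 - q) * f p] times the total mass, which is 1 by [sum_thin_weight]. *)
Lemma sum_thin_weight_sum A (f : T -> R) :
  \sum_(s <- fpowerset A) thin_weight A s * \sum_(p <- s) f p =
  (1 - q) * \sum_(p <- A) f p.
Proof.
elim/finSet_rect: A => A IH; have [->|[p pA]] := fset_0Vmem A.
  by rewrite fpowerset0 big_seq_fset1 !big_seq_fset0 !mulr0.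
have := IH _ (fproperD1 pA); have := fsetD1K pA.
set B := (A `\ p)%fset => BA IHB.
have pB : p \notin B by rewrite !inE eqxx.
rewrite -BA (@sum_thin_weightU1 p B (fun s => \sum_(p <- s) f p))//.
rewrite big_fsetU1//= mulrDr -IHB.
rewrite -[(1 - q) * f p]mul1r -[X in X * _](sum_thin_weight B) mulr_suml.
rewrite -big_split big_seq [RHS]big_seq; apply: eq_bigr => s.
rewrite fpowersetE => sB.
rewrite big_fsetU1/=; last by apply: contra pB => /(fsubsetP sB).
ring.
Qed.

End random_subset.

Lemma probability1_setIl d (T : measurableType d) (R : realType)
    (P : probability T R) (A B : set T) :
  measurable A -> measurable B -> P A = 1%E -> P (A `&` B) = P B.
Proof.
move=> mA mB A1; rewrite (measureDI P mB mA) setIC.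
rewrite (@subset_measure0 _ _ _ P (B `\` A) (~` A)) ?add0e//.
- exact: measurableD.
- exact: measurableC.
- by rewrite [LHS]probability_setC// A1 subee.
Qed.

(** * The transition law as a measure *)

Section transition_law.
Context {R : realType}.
Variables (W : set (R * R)) (cW : compact W) (K : R).
Variables (nu : probability (measurableTypeR R) R) (lambda beta pd : R).
Hypothesis K_gt0 : 0 < K.
Hypothesis nuK : nu [set` `[0, K]] = 1%E.
Hypothesis beta_ge0 : 0 <= beta.
Hypothesis pd_ge0 : 0 <= pd.
Hypothesis pd_le1 : pd <= 1.
Local Notation state := (state W K).
Local Notation newborn := (newborn cW nu).
Local Notation logistic := (logistic K lambda).
Local Notation grown := (grown K lambda).
Local Notation pmf := (birth_count_pmf W beta).
Local Notation rate := (beta * fine (area W)).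

Lemma logistic_itv n m : 0 <= m <= K -> 0 <= logistic n m <= K.
Proof.
move=> /andP[m0 mK]; rewrite /Defs.logistic; have [_|mN0] := eqVneq m 0.
  by rewrite lexx ltW.
have {mN0}m0 : 0 < m by rewrite lt_neqAle eq_sym mN0.
have d1 : 1 <= 1 + (K / m - 1) * expR (- (lambda * n%:R)).
  by rewrite lerDl mulr_ge0 ?expR_ge0// subr_ge0 ler_pdivlMr// mul1r.
have d0 := lt_le_trans ltr01 d1.
rewrite divr_ge0 ?(ltW K_gt0) ?(ltW d0)//=.
by rewrite ler_pdivrMr// ler_peMr// ltW.
Qed.

Lemma grown_inj (x : pattern W K) (s : {fset R * R *
  R}) : (s `<=` points x)%fset ->
  {in s &, injective (fun p : R * R * R => (p.1, logistic 1 p.2))}.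
Proof.
move=> /fsubsetP sx p q /sx px /sx qx [pq _].
by apply: (pattern_inj px qx); exact: pq.
Qed.

Lemma grown_is_pattern (x : pattern W K) (s : {fset R * R * R}) :
  (s `<=` points x)%fset -> is_pattern W K (grown s).
Proof.
move=> sx; split=> [_ /imfsetP[p /= ps ->]|_ _ /imfsetP[p /= ps ->] /imfsetP[q
  /= qs ->] /= pq].
  have [Wp Kp] := pattern_in (fsubsetP sx _ ps).
  by split => //=; apply: logistic_itv.
by rewrite (pattern_inj (fsubsetP sx _ ps) (fsubsetP sx _ qs) pq).
Qed.

Lemma sum_grown (x : pattern W K) (s : {fset R * R * R}) (h : R -> R) :
  (s `<=` points x)%fset ->
  \sum_(p <- grown s) h p.2 = \sum_(p <- s) h (logistic 1 p.2).
Proof. by move=> /grown_inj inj; rewrite big_imfset. Qed.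

Lemma rate_ge0 : 0 <= rate.
Proof. by rewrite mulr_ge0// fine_ge0. Qed.

Lemma birth_count_pmf_ge0 k : 0 <= pmf k.
Proof. by rewrite divr_ge0// mulr_ge0 ?expR_ge0// exprn_ge0// rate_ge0. Qed.

Lemma birth_count_pmf_sum :
  (\sum_(0 <= k <oo) (pmf k)%:E = 1)%E.
Proof.
transitivity (\sum_(0 <= k <oo) (expR (- rate))%:E * (rate ^+ k / k`!%:R)%:E)%E.
  by apply: eq_eseriesr => k _; rewrite -EFinM mulrA.
rewrite nneseriesZl; last first.
  by move=> k _; rewrite lee_fin divr_ge0 ?exprn_ge0// rate_ge0.
by rewrite exp_eseries ?rate_ge0// -EFinM mulrC expRxMexpNx_1.
Qed.

Lemma birth_count_pmf_mean :
  (\sum_(0 <= k <oo) (pmf k * k%:R)%:E = rate%:E)%E.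
Proof.
transitivity (\sum_(0 <= k <oo) (expR (- rate))%:E * (rate ^+ k / k`!%:R *
  k%:R)%:E)%E.
  by apply: eq_eseriesr => k _; rewrite -EFinM !mulrA.
rewrite nneseriesZl; last first.
  by move=> k _; rewrite lee_fin mulr_ge0 ?divr_ge0 ?exprn_ge0// rate_ge0.
by rewrite exp_eseries_mean ?rate_ge0// -EFinM mulrCA [X in _ *
  X]mulrC expRxMexpNx_1 mulr1.
Qed.

(** If [W] is null the rate is 0, so a positive weight forces [k] to be 0, and the empty sample is
    fresh. *)
Lemma newborn_fresh k L : pmf k != 0 -> iid newborn k (@fresh R W K L k) = 1%E.
Proof.
move=> pk.
have [W0|W0] := ltP 0 (fine (area W)).
  by apply: iid_fresh => //; [exact: newborn_space|exact: newborn_location].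
have {}W0 : fine (area W) = 0 by apply/eqP; rewrite eq_le W0 fine_ge0.
case: k pk => [_|k]; last first.
  by rewrite /birth_count_pmf W0 mulr0 exprS mul0r mulr0 mul0r eqxx.
rewrite /= diracE mem_set//; split; first by case.
by split=> [[]|[]].
Qed.

(** The measure is the mixture, over survivor sets and birth counts, of the images of iid samples
    under [birth]; the second clause integrates term by term. *)
Lemma transition_measure (a : state) :
  exists mu : {measure set state -> \bar R},
    (forall B, measurable B -> transition cW nu lambda beta pd a B = mu B) /\
    (forall f : state -> \bar R, (forall x, 0 <= f x)%E ->
      measurable_fun setT f ->
      \int[mu]_y f y = \sum_(s <- fpowerset (points a))
        (thin_weight pd (points a) s)%:E *
        \sum_(0 <= k <oo) (pmf k)%:E *
          \int[iid newborn k]_t f (birth W K (grown (s `&` points a)%fset)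
            t))%E.
Proof.
(* Intersecting with [points a] gives a pattern for every [s], so the families of measures below are
   total in [s]. *)
have patI s : is_pattern W K (grown (s `&` points a)%fset).
  exact: (@grown_is_pattern a _ (fsubsetIr _ _)).
pose m s k : {measure set state -> \bar R} :=
  distribution (iid newborn k)
   (mfun_Sub (mem_set (measurable_birth cW (patI s) (k := k)))).
have w0 s : 0 <= thin_weight pd (points a) s.
  by rewrite mulr_ge0// exprn_ge0// subr_ge0.
pose ms s := sval (cid (ge0_integral_wseries (m s) birth_count_pmf_ge0)).
have msP s := svalP (cid (ge0_integral_wseries (m s) birth_count_pmf_ge0)).
have [mu [mu1 mu2]] := ge0_integral_wsum (fpowerset (points a)) ms w0.
exists mu; split => [B mB|f f0 mf].
  rewrite mu1 /transition big_seq [RHS]big_seq; apply: eq_bigr => s.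
  rewrite fpowersetE => sa; congr (_ * _)%E.
  have [-> _] := msP s; apply: eq_eseriesr => k _.
  have [->|pk] := eqVneq (pmf k) 0; first by rewrite !mul0e.
  congr (_ * _)%E.
  have sE : grown (s `&` points a)%fset = grown s.
    by congr Defs.grown; apply/fsetIidPl.
  rewrite -sE [X in iid newborn k X](birth_setE _ _ B).
  apply: probability1_setIl.
  - exact: measurable_birth_ok.
  - by rewrite -[X in measurable X]setTI; exact: measurable_birth.
  (* Fresh samples have probability 1 and yield patterns, so valid samples have probability 1. *)
  rewrite -(@probability1_setIl _ _ _ (iid newborn k) (fresh W K [seq p.1 | p
    <- grown (s `&` points a)%fset] (k := k))).
  - rewrite setIidl; first exact: newborn_fresh.
    by move=> t /(fresh_with_births (patI s))[].
  - exact: measurable_fresh.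
  - exact: measurable_birth_ok.
  - exact: newborn_fresh.
rewrite mu2//; apply: eq_bigr => s _; congr (_ * _)%E.
have [_ ->] := msP s => //; apply: eq_eseriesr => k _; congr (_ * _)%E.
rewrite [LHS]ge0_integral_distribution//.
Qed.

End transition_law.

(** * Means of additive functionals of the next state *)

Section transition_integral.
Context {R : realType}.
Variables (W : set (R * R)) (cW : compact W) (K : R).
Variables (nu : probability (measurableTypeR R) R) (lambda beta pd : R).
Hypothesis K_gt0 : 0 < K.
Hypothesis nuK : nu [set` `[0, K]] = 1%E.
Hypothesis beta_ge0 : 0 <= beta.
Hypothesis pd_ge0 : 0 <= pd.
Hypothesis pd_le1 : pd <= 1.
Local Notation state := (state W K).
Local Notation newborn := (newborn cW nu).
Local Notation logistic := (logistic K lambda).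
Local Notation grown := (grown K lambda).
Local Notation pmf := (birth_count_pmf W beta).
Local Notation rate := (beta * fine (area W)).

Variables (h : R -> R) (J C c : R).
Hypothesis ch : continuous h.
Hypothesis h_ge0 : forall m, 0 <= h m.
Hypothesis hJ : (\int[nu]_m (h m)%:E = J%:E)%E.
Hypothesis C_ge0 : 0 <= C.
Hypothesis c_ge0 : 0 <= c.

Let f (y : state) : \bar R := (C + c * \sum_(p <- points y) h p.2)%:E.

Lemma measurable_sum_marks :
  measurable_fun setT (fun y : state => \sum_(p <- points y) h p.2).
Proof.
apply: (measurable_sum_points (f := fun p => h p.2)).
apply: continuous_subspaceT => p.
by apply: continuous_comp; [exact: cvg_snd|exact: ch].
Qed.

Let mf : measurable_fun setT f.
Proof.
apply/measurable_EFinP; apply: measurable_funD; first exact: measurable_cst.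
by apply: measurable_funM; [exact: measurable_cst|exact: measurable_sum_marks].
Qed.

Let f0 y : (0 <= f y)%E.
Proof. by rewrite lee_fin addr_ge0// mulr_ge0// sumr_ge0. Qed.

Let J_ge0 : 0 <= J.
Proof. by rewrite -lee_fin -hJ integral_ge0// => m _; rewrite lee_fin. Qed.

(** On the almost sure event that the sample is fresh, the sum over the pattern is the sum over [S]
    plus the sum over the sample. *)
Lemma integral_births (S : {fset R * R * R}) k : is_pattern W K S ->
  pmf k != 0 ->
  (\int[iid newborn k]_t f (birth W K S t) =
   (C + c * \sum_(p <- S) h p.2 + c * J * k%:R)%:E)%E.
Proof.
move=> patS pk.
pose g (t : k.-tuple (mpoint R)) : \bar R :=
  ((C + c * \sum_(p <- S) h p.2)%:E +
    c%:E * (\sum_(p <- (t : seq (mpoint R))) h p.2)%:E)%E.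
have mh : measurable_fun setT (fun p : mpoint R => h p.2).
  exact: (measurableT_comp (continuous_measurable_fun ch)
    (@measurable_snd _ _ (plane R) (measurableTypeR R))).
have mSR : measurable_fun setT
    (fun t : k.-tuple (mpoint R) => \sum_(p <- (t : seq (mpoint R))) h p.2).
  under eq_fun do rewrite big_tuple.
  apply: measurable_sum => i;
    exact: (measurableT_comp mh (@measurable_tnth _ (mpoint R) k i)).
have mS : measurable_fun setT
    (fun t : k.-tuple (mpoint R) =>
      (\sum_(p <- (t : seq (mpoint R))) h p.2)%:E).
  exact/measurable_EFinP.
have S0 (t : k.-tuple (mpoint R)) : (0 <= (\sum_(p <- (t : seq (mpoint R))) h
  p.2)%:E)%E.
  by rewrite lee_fin sumr_ge0.
have A0 : 0 <= C + c * \sum_(p <- S) h p.2 by rewrite addr_ge0// mulr_ge0//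
  sumr_ge0.
have mcS : measurable_fun setT (fun t : k.-tuple (mpoint R) =>
  c%:E * (\sum_(p <- (t : seq (mpoint R))) h p.2)%:E)%E.
  by apply: emeasurable_funM => //; exact: measurable_cst.
transitivity (\int[iid newborn k]_t g t)%E.
  apply: ge0_ae_eq_integral => //.
  - by apply: measurableT_comp => //; exact: measurable_birth.
  - by apply: emeasurable_funD => //; exact: measurable_cst.
  - by move=> t _; apply: adde_ge0; [rewrite lee_fin|apply: mule_ge0;
    [rewrite lee_fin|exact: S0]].
  exists (~` fresh W K [seq p.1 | p <- S] (k := k)); split.
  - by apply: measurableC; exact: measurable_fresh.
  - rewrite [LHS]probability_setC; last exact: measurable_fresh.
    by rewrite [X in (_ - X)%E](newborn_fresh cW nuK _ pk) subee.
  move=> t /= nfg ft; apply: nfg => _.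
  have [ok pS] := fresh_with_births patS ft.
  rewrite /f /g birthP// (perm_big _ pS) big_cat /=.
  by rewrite -EFinM -EFinD mulrDr addrA.
rewrite ge0_integralD//; last by move=> t _; apply: mule_ge0;
  [rewrite lee_fin|exact: S0].
rewrite integral_cst// [X in (_ * X)%E]probability_setT mule1.
rewrite ge0_integralZl//.
rewrite (ge0_integral_iid_sum _ _ mh)//.
rewrite ge0_integral_newborn_mark//; last exact: continuous_measurable_fun.
by rewrite hJ -!EFinM -EFinD [k%:R * J]mulrC mulrA.
Qed.

(** Averaging over the birth count uses the mass and mean of the Poisson law; averaging over
    survivors uses [sum_thin_weight_sum]. *)
Lemma integral_transition (a : state) :
  (\int[transition cW nu lambda beta pd a]_y f y =
   (C + c * ((1 - pd) * \sum_(p <- points a) h (logistic 1 p.2) +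
     rate * J))%:E)%E.
Proof.
have [mu [muE muI]] := @transition_measure R W cW K nu lambda beta pd
  K_gt0 nuK beta_ge0 pd_ge0 pd_le1 a.
rewrite (eq_integral_setfun f muE) muI//.
have series (A B : R) : 0 <= A -> 0 <= B ->
    (\sum_(0 <= k <oo) (pmf k)%:E * (A + B * k%:R)%:E = (A + B * rate)%:E)%E.
  move=> A0 B0; have pmf0 := birth_count_pmf_ge0 W beta_ge0.
  transitivity (\sum_(0 <= k <oo) (A%:E * (pmf k)%:E +
    B%:E * (pmf k * k%:R)%:E))%E.
    apply: eq_eseriesr => k _; rewrite -!EFinM -EFinD; congr EFin; ring.
  rewrite nneseriesD; last 2 first.
  - by move=> k _ _; rewrite -EFinM lee_fin; do ![apply: mulr_ge0 => //].
  - by move=> k _ _; rewrite -EFinM lee_fin; do ![apply: mulr_ge0 => //].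
  rewrite !nneseriesZl; last 2 first.
  - by move=> k _; rewrite lee_fin mulr_ge0.
  - by move=> k _; rewrite lee_fin pmf0.
  by rewrite birth_count_pmf_sum// birth_count_pmf_mean// mule1 -EFinM -EFinD.
transitivity (\sum_(s <- fpowerset (points a)) (thin_weight pd (points a) s *
    (C + c * J * rate + c * \sum_(p <- s) h (logistic 1 p.2)))%:E)%E.
  rewrite big_seq [RHS]big_seq; apply: eq_bigr => s; rewrite fpowersetE => sa.
  have -> : (s `&` points a)%fset = s by apply/fsetIidPl.
  rewrite [RHS]EFinM -(sum_grown lambda h sa); congr (_ * _)%E.
  have patS := grown_is_pattern lambda K_gt0 sa.
  transitivity (\sum_(0 <= k <oo) (pmf k)%:E *
      (C + c * \sum_(p <- grown s) h p.2 + c * J * k%:R)%:E)%E.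
    apply: eq_eseriesr => k _; have [->|pk] := eqVneq (pmf k) 0.
      by rewrite !mul0e.
    by rewrite integral_births.
  by rewrite series ?mulr_ge0 ?addr_ge0 ?mulr_ge0 ?sumr_ge0// addrAC.
rewrite sumEFin; congr EFin.
transitivity (\sum_(s <- fpowerset (points a)) thin_weight pd (points a) s *
    (C + c * J * rate) + c * \sum_(s <- fpowerset (points a))
    thin_weight pd (points a) s * \sum_(p <- s) h (logistic 1 p.2)).
  rewrite mulr_sumr -big_split; apply: eq_bigr => s _.
  by rewrite mulrDr; congr (_ + _); exact: mulrCA.
rewrite -mulr_suml sum_thin_weight mul1r.
by rewrite (sum_thin_weight_sum pd _ (fun p => h (logistic 1 p.2))); ring.
Qed.

End transition_integral.

(** * Optimal harvest of a single point *)

Section bigmax_lemmas.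
Context {d : Order.disp_t} {T : orderType d} {I : Type}.
Implicit Types (a b x z : T) (s : seq I) (F : I -> T).
Local Notation max := Order.max.

(** The seed of [best_harvest] is a genuine term; this exchanges it with a term that has been split
    off. *)
Lemma bigmax_swap a b s F :
  max a (\big[max/b]_(i <- s) F i) = max b (\big[max/a]_(i <- s) F i).
Proof.
elim: s => [|i s IH]; first by rewrite !big_nil maxC.
by rewrite !big_cons maxCA IH maxCA.
Qed.

Lemma lt_bigmax z x s F :
  (z < \big[max/x]_(i <- s) F i)%O = (z < x)%O || has (fun i => z < F i)%O s.
Proof.
elim: s => [|i s IH]; first by rewrite big_nil orbF.
by rewrite big_cons lt_max IH /= orbCA.
Qed.

End bigmax_lemmas.

Section harvest.
Context {R : realType}.
Variables (K lambda pd alpha : R).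
Hypothesis K_gt0 : 0 < K.
Hypothesis lambda_gt0 : 0 < lambda.
Hypothesis pd_ge0 : 0 <= pd.
Hypothesis pd_le1 : pd <= 1.
Hypothesis alpha_ge0 : 0 <= alpha.
Hypothesis alpha_le1 : alpha <= 1.
Local Notation logistic := (logistic K lambda).
Local Notation best_harvest := (best_harvest K lambda pd alpha).
Local Notation threshold := (threshold K lambda pd alpha).
Local Notation q := (alpha * (1 - pd)).

(** Clearing m from the denominator makes mark 0 unexceptional. *)
Lemma logisticE n m : 0 <= m <= K ->
  logistic n m = K * m / (m + (K - m) * expR (- (lambda * n%:R))).
Proof.
move=> /andP[m0 mK]; rewrite /Defs.logistic; case: eqVneq => [->|mN0].
  by rewrite mulr0 mul0r.
have {mN0}m0 : 0 < m by rewrite lt_neqAle eq_sym mN0.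
have e0 := expR_gt0 (- (lambda * n%:R)).
set e := expR _ in e0 *.
have d0 : 0 < m + (K - m) * e by rewrite ltr_wpDr// mulr_ge0 ?subr_ge0// ltW.
have -> : 1 + (K / m - 1) * e = (m + (K - m) * e) / m.
  by field; rewrite gt_eqF.
by field; rewrite !gt_eqF.
Qed.

Lemma logistic_logistic n m : 0 <= m <= K ->
  logistic n (logistic 1 m) = logistic n.+1 m.
Proof.
move=> mK; rewrite (logisticE _ (logistic_itv lambda K_gt0 1 mK)) !logisticE//.
have -> : expR (- (lambda * n.+1%:R)) =
    expR (- (lambda * 1)) * expR (- (lambda * n%:R)).
  by rewrite -expRD -natr1; congr expR; ring.
rewrite mulr1; move: mK => /andP[m0 mK].
have e0 := expR_gt0 (- lambda); have en0 := expR_gt0 (- (lambda * n%:R)).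
set e := expR _ in e0 *; set en := expR _ in en0 *.
have [->|mN0] := eqVneq m 0; first by rewrite !(mulr0, mul0r).
have {mN0}m0' : 0 < m by rewrite lt_neqAle eq_sym mN0.
have d (x : R) : 0 < x -> 0 < m + (K - m) * x.
  by move=> x0; rewrite ltr_wpDr// mulr_ge0 ?subr_ge0// ltW.
have d1 := d _ e0; have d2 := d _ (mulr_gt0 e0 en0).
have -> : K * m / (m + (K - m) * e) + (K - K * m / (m + (K - m) * e)) * en =
   K * (m + (K - m) * (e * en)) / (m + (K - m) * e).
  by field; rewrite gt_eqF.
by field; rewrite !gt_eqF.
Qed.

(* Clamping to [0, K] makes the functions below continuous and nonnegative  *)
(* on the whole line, while they are only used at marks, which lie there.   *)
Definition clamp (m : R) : R := Num.max 0 (Num.min m K).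

Definition growth (m : R) : R :=
  K * clamp m / (clamp m + (K - clamp m) * expR (- lambda)).

Fixpoint harvest (n : nat) (m : R) : R :=
  if n is n'.+1 then Num.max (clamp m) (q * harvest n' (growth m)) else 0.

Lemma clamp_itv m : 0 <= clamp m <= K.
Proof.
by rewrite /clamp le_max lexx /= ge_max (ltW K_gt0) ge_min lexx orbT.
Qed.

Lemma clamp_id m : 0 <= m <= K -> clamp m = m.
Proof. by move=> /andP[m0 mK]; rewrite /clamp min_l// max_r. Qed.

Lemma growthE m : 0 <= m <= K -> growth m = logistic 1 m.
Proof. by move=> mK; rewrite /growth clamp_id// logisticE// mulr1. Qed.

Lemma growth_clamp m : growth m = logistic 1 (clamp m).
Proof. by rewrite logisticE ?clamp_itv// mulr1. Qed.

Lemma q_ge0 : 0 <= q. Proof. by rewrite mulr_ge0// subr_ge0. Qed.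

Lemma q_le1 : q <= 1.
Proof. by rewrite mulr_ile1 ?subr_ge0// lerBlDr lerDl. Qed.

Lemma harvest_itv n m : 0 <= harvest n m <= K.
Proof.
elim: n m => [|n IH] m /=; first by rewrite lexx ltW.
have /andP[c0 cK] := clamp_itv m; have /andP[h0 hK] := IH (growth m).
rewrite le_max c0 /= ge_max cK /=.
by rewrite (le_trans _ hK)// ler_piMl// q_le1.
Qed.

Lemma continuous_clamp : continuous clamp.
Proof.
move=> m; apply: (@continuous_max R R (cst 0) (fun m => Num.min m K)).
  exact: cst_continuous.
apply: (@continuous_min R R id (cst K)); first exact: cvg_id.
exact: cst_continuous.
Qed.

Lemma growth_den_gt0 m : 0 < clamp m + (K - clamp m) * expR (- lambda).
Proof.
have /andP[c0 cK] := clamp_itv m; have e0 := expR_gt0 (- lambda).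
move: c0; rewrite le_eqVlt => /predU1P[<-|c0].
  by rewrite add0r subr0 mulr_gt0.
by rewrite ltr_wpDr// mulr_ge0 ?subr_ge0// ltW.
Qed.

Lemma continuous_growth : continuous growth.
Proof.
move=> m; apply: cvgM.
  by apply: cvgM; [exact: cvg_cst|exact: continuous_clamp].
apply: cvgV; first by rewrite gt_eqF// growth_den_gt0.
apply: cvgD; first exact: continuous_clamp.
apply: cvgM; last exact: cvg_cst.
by apply: cvgB; [exact: cvg_cst|exact: continuous_clamp].
Qed.

Lemma continuous_harvest n : continuous (harvest n).
Proof.
elim: n => [|n IH] m /=; first exact: cvg_cst.
apply: (@continuous_max R R clamp (fun m => q * harvest n (growth m))).
  exact: continuous_clamp.
apply: cvgM; first exact: cvg_cst.
by apply: continuous_comp; [exact: continuous_growth|exact: IH].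
Qed.

(** By the semigroup law, the term of index j + 1 at m is [q] times the term of index j at the grown
    mark, and a nonnegative factor passes through the maximum. *)
Lemma best_harvestS n m : 0 <= m <= K ->
  best_harvest n.+2 m = Num.max m (q * best_harvest n.+1 (logistic 1 m)).
Proof.
move=> mK; rewrite /Defs.best_harvest big_nat_recl//= bigmax_swap.
congr Num.max; rewrite !expr1.
rewrite (big_morph _ (fun x y => maxr_pMr x y q_ge0) erefl).
apply: eq_bigr => j _; rewrite logistic_logistic// !exprS; ring.
Qed.

(** With no step left [harvest] is 0 while [best_harvest] is still m, hence the shift by one. *)
Lemma harvestE n m : 0 <= m <= K -> harvest n.+1 m = best_harvest n.+1 m.
Proof.
elim: n m => [|n IH] m mK.
  rewrite /= mulr0 clamp_id// max_l; last by case/andP: mK.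
  by rewrite /Defs.best_harvest big_geq.
rewrite best_harvestS// -IH; last exact: logistic_itv.
by rewrite [LHS]/= clamp_id// growthE.
Qed.

Lemma harvest0 n : harvest n 0 = 0.
Proof.
have c0 : clamp 0 = 0 by rewrite clamp_id// lexx ltW.
have g0 : growth 0 = 0 by rewrite /growth c0 mulr0 mul0r.
by elim: n => //= n IH; rewrite g0 IH c0 mulr0 maxxx.
Qed.

(** With e the exponential and Q the discounted survival factor, both sides reduce to m (1 - e) < K
    (Q - e), the right one after cancelling a factor m > 0. *)
Lemma lt_threshold_term i m : 0 < m <= K -> (0 < i)%N ->
  (m < K * ((alpha ^+ i * (1 - pd) ^+ i - expR (- (i%:R * lambda))) /
          (1 - expR (- (i%:R * lambda))))) =
  (m < alpha ^+ i * (1 - pd) ^+ i * logistic i m).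
Proof.
move=> /andP[m0 mK] i0; rewrite logisticE; last by rewrite ltW.
rewrite [i%:R * lambda]mulrC.
have e0 := expR_gt0 (- (lambda * i%:R)).
have e1 : expR (- (lambda * i%:R)) < 1.
  by rewrite expR_lt1 oppr_lt0 mulr_gt0// ltr0n.
set e := expR _ in e0 e1 *; set Q := alpha ^+ i * _.
have d0 : 0 < m + (K - m) * e by rewrite ltr_wpDr// mulr_ge0 ?subr_ge0// ltW.
rewrite !mulrA ltr_pdivlMr ?subr_gt0// ltr_pdivlMr//.
rewrite -subr_gt0 -[RHS]subr_gt0.
have -> : Q * K * m - m * (m + (K - m) * e) = m * (K * (Q - e) - m * (1 - e)).
  by ring.
by rewrite pmulr_rgt0.
Qed.

(** A maximum exceeds m when its seed or a term does; the seeds 0 and m never do, and the terms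
    match one by one. *)
Lemma lt_threshold n m : 0 < m <= K ->
  (m < threshold n) = (m < best_harvest n m).
Proof.
move=> mK; rewrite /Defs.threshold /Defs.best_harvest !lt_bigmax.
have /andP[m0 _] := mK.
rewrite ltxx ltNge (ltW m0) /=; apply: eq_in_has => i.
by rewrite mem_index_iota => /andP[i0 _]; rewrite lt_threshold_term.
Qed.

(** At mark 0 both branches vanish, so the equivalence for positive marks suffices. *)
Lemma harvest_threshold n m : 0 <= m <= K ->
  harvest n.+1 m =
  if m < threshold n.+1 then q * harvest n (logistic 1 m) else m.
Proof.
move=> mK; have /andP[] := mK; rewrite le_eqVlt => /predU1P[<-|m0] mK'.
  rewrite -growthE ?lexx ?ltW// harvest0.
  have -> : growth 0 = 0 by rewrite growthE ?lexx ?ltW// /Defs.logistic eqxx.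
  by rewrite harvest0 mulr0 if_same.
rewrite lt_threshold ?m0// -harvestE// [harvest n.+1 m]/= clamp_id// growthE//.
by rewrite lt_max ltxx /=; case: ltP.
Qed.

Lemma harvest_ge n m : 0 <= m <= K ->
  m <= harvest n.+1 m /\ q * harvest n (logistic 1 m) <= harvest n.+1 m.
Proof. by move=> mK; rewrite /= clamp_id// growthE// !le_max !lexx orbT. Qed.

End harvest.

(** * The Bellman equation *)

Section optimal_harvest.
Context {R : realType}.
Variables (W : set (R * R)) (cW : compact W) (K : R).
Variables (nu : probability (measurableTypeR R) R).
Variables (lambda beta pd c alpha : R).
Hypothesis K_gt0 : 0 < K.
Hypothesis nuK : nu [set` `[0, K]] = 1%E.
Hypothesis lambda_gt0 : 0 < lambda.
Hypothesis beta_ge0 : 0 <= beta.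
Hypothesis pd_ge0 : 0 <= pd.
Hypothesis pd_le1 : pd <= 1.
Hypothesis c_ge0 : 0 <= c.
Hypothesis alpha_ge0 : 0 <= alpha.
Hypothesis alpha_le1 : alpha <= 1.
Local Notation state := (state W K).
Local Notation logistic := (logistic K lambda).
Local Notation rate := (beta * fine (area W)).
Local Notation harvest := (harvest K lambda pd alpha).
Local Notation threshold := (threshold K lambda pd alpha).
Local Notation reward := (reward c).
Local Notation disc := (discounted_reward c alpha).
Local Notation transition := (transition cW nu lambda beta pd).
Local Notation expectation phi :=
  (expectation_from cW nu lambda beta pd phi (fun h => (disc h)%:E)).

Definition mean_harvest n : R := fine (\int[nu]_m (harvest n m)%:E)%E.

Let harvest_ge0 n m : 0 <= harvest n m.
Proof. by have /andP[] := harvest_itv lambda K_gt0 pd_ge0 pd_le1 alpha_ge0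
  alpha_le1 n m. Qed.

Let measurable_harvest n : measurable_fun [set: measurableTypeR R] (harvest n).
Proof. by apply: continuous_measurable_fun; exact: continuous_harvest. Qed.

Lemma mean_harvestE n :
  (\int[nu]_m (harvest n m)%:E = (mean_harvest n)%:E)%E.
Proof.
rewrite fineK// ge0_fin_numE; last first.
  by apply: integral_ge0 => m _; rewrite lee_fin.
apply: (@le_lt_trans _ _ (\int[nu]_m K%:E)%E).
  apply: ge0_le_integral_raw => m; rewrite lee_fin//.
  by have /andP[] := harvest_itv lambda K_gt0 pd_ge0 pd_le1 alpha_ge0
    alpha_le1 n m.
by rewrite integral_cst// [X in (_ * X)%E]probability_setT mule1 ltry.
Qed.

Lemma mean_harvest_ge0 n : 0 <= mean_harvest n.
Proof. by rewrite fine_ge0// integral_ge0// => m _; rewrite lee_fin. Qed.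

(** [nu] is carried by [0, K], where clamping changes nothing. *)
Lemma mean_harvest_best n : mean_harvest n.+1 =
  \int[nu]_(m in [set` `[0, K]]) best_harvest K lambda pd alpha n.+1 m.
Proof.
rewrite /mean_harvest /Rintegral; congr fine.
have mI : measurable ([set` `[0, K]] : set (measurableTypeR R)).
  exact: measurable_itv.
rewrite (@ge0_negligible_integral _ _ _ nu setT (~` [set` `[0, K]]))//.
- rewrite setTD setCK; apply: eq_integral => m; rewrite inE => mK.
  by rewrite (harvestE lambda K_gt0 pd_le1 alpha_ge0).
- exact: measurableC.
- by apply/measurable_EFinP.
- by move=> m _; rewrite lee_fin.
- by rewrite [LHS]probability_setC// [X in (_ - X)%E]nuK subee.
Qed.

(** Expected discounted harvest from points not yet born, in units of [c]; those born in the coming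
    transition have one step fewer left. *)
Fixpoint births_value n : R :=
  if n is n'.+1 then alpha * (births_value n' + rate * mean_harvest n') else 0.

Lemma births_valueE n : births_value n =
  rate * \sum_(1 <= k < n) alpha ^+ k * mean_harvest (n - k).
Proof.
elim: n => [|n IH]; first by rewrite big_geq// mulr0.
rewrite /= IH big_add1 /=.
have -> : \sum_(0 <= k < n) alpha ^+ k.+1 * mean_harvest (n.+1 - k.+1) =
  alpha * \sum_(0 <= k < n) alpha ^+ k * mean_harvest (n - k).
  by rewrite mulr_sumr; apply: eq_bigr => k _; rewrite exprS subSS mulrA.
(* For n = 0 there is no index 0 term to split off, but the birth term vanishes because [harvest 0]
   is 0. *)
case: n {IH} => [|n].
  rewrite !big_geq// /mean_harvest (_ : (\int[nu]_m (harvest 0 m)%:E)%E = 0%E).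
    by rewrite !mulr0 addr0 mulr0.
  exact: integral0_eq.
by rewrite [in RHS]big_ltn// expr0 mul1r subn0; ring.
Qed.

(** The claimed optimum, written with [harvest] so that it is 0 at horizon 0. *)
Definition value n (x : state) : R :=
  c * (births_value n + \sum_(p <- points x) harvest n p.2).

Lemma births_value_ge0 n : 0 <= births_value n.
Proof.
elim: n => //= n IH; rewrite mulr_ge0// addr_ge0// mulr_ge0//.
  exact: rate_ge0.
exact: mean_harvest_ge0.
Qed.

Lemma mark_itv (x : state) p : p \in points x -> 0 <= p.2 <= K.
Proof. by move=> /pattern_in[_]. Qed.

Lemma reward_ge0 (x a : state) : 0 <= reward x a.
Proof.
rewrite mulr_ge0// big_seq sumr_ge0// => p; rewrite !inE => /andP[_ px].
by have /andP[] := mark_itv px.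
Qed.

Lemma disc_ge0 (h : seq (state * state)) : 0 <= disc h.
Proof. by apply: sumr_ge0 => i _; rewrite mulr_ge0 ?exprn_ge0// reward_ge0. Qed.

Lemma disc_rcons i (h : i.-tuple (state * state)) (x a : state) :
  disc (rcons h (x, a)) = disc h + alpha ^+ i * reward x a.
Proof.
rewrite /discounted_reward size_rcons big_ord_recr /= size_tuple.
congr (_ + _ * _); last by rewrite nth_rcons size_tuple ltnn eqxx.
by apply: eq_bigr => j _; rewrite nth_rcons size_tuple ltn_ord.
Qed.

(** The Bellman functional, with the expectation of [value n] at the next state already
    evaluated. *)
Definition action_value n (x a : state) : R :=
  reward x a + alpha * (c * (births_value n +
    ((1 - pd) * \sum_(p <- points a) harvest n (logistic 1 p.2) +
     rate * mean_harvest n))).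

(** The birth terms cancel, leaving for each removed point its loss from not waiting and for each
    retained point its loss from waiting. *)
Lemma valueSE n (x a : state) : (points a `<=` points x)%fset ->
  value n.+1 x - action_value n x a =
  c * (\sum_(p <- (points x `\` points a)%fset) (harvest n.+1 p.2 - p.2) +
   \sum_(p <- points a)
     (harvest n.+1 p.2 - alpha * (1 - pd) * harvest n (logistic 1 p.2))).
Proof.
move=> ax; rewrite /value /action_value /Defs.reward [births_value n.+1]/=.
have xE : perm_eq (points x) ((points x `\` points a)%fset ++ points a).
  apply: uniq_perm; first exact: fset_uniq.
    rewrite cat_uniq !fset_uniq andbT /=; apply/hasPn => p pa.
    by rewrite !inE pa.
  move=> p; rewrite mem_cat !inE.
  by have [/(fsubsetP ax) ->|] := boolP (p \in points a); rewrite ?orbT ?orbF.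
rewrite (perm_big _ xE) big_cat /= !big_split /= !sumrN -!mulr_sumr; ring.
Qed.

Lemma action_value_le n (x a : state) : (points a `<=` points x)%fset ->
  action_value n x a <= value n.+1 x.
Proof.
move=> ax; rewrite -subr_ge0 valueSE// mulr_ge0// addr_ge0//;
  rewrite big_seq sumr_ge0// => p; rewrite ?inE.
  move=> /andP[_ /mark_itv pK]; rewrite subr_ge0.
  by case: (harvest_ge lambda pd alpha n pK).
move=> /mark_itv pK; rewrite subr_ge0.
by case: (harvest_ge lambda pd alpha n pK).
Qed.

Lemma french_thinning_sub d (x : state) :
  (points (french_thinning d x) `<=` points x)%fset.
Proof. by apply/fsubsetP => p; rewrite !inE => /andP[]. Qed.

Lemma action_value_french_thinning n (x : state) :
  action_value n x (french_thinning (threshold n.+1) x) = value n.+1 x.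
Proof.
apply/eqP; rewrite eq_sym -subr_eq0 valueSE ?french_thinning_sub//.
rewrite big_seq big1 ?add0r; last first.
  move=> p; rewrite !inE => /andP[pn px]; rewrite px /= in pn.
  by rewrite harvest_threshold ?(mark_itv px)// (negbTE pn) subrr.
rewrite big_seq big1 ?mulr0// => p; rewrite !inE => /andP[px pd'].
by rewrite harvest_threshold ?(mark_itv px)// pd' subrr.
Qed.

(** [C] and [e] will carry the reward already collected and the current discount. *)
Lemma integral_transition_value n (C e : R) (a : state) : 0 <= C -> 0 <= e ->
  (\int[transition a]_y (C + e * value n y)%:E =
   (C + e * (c * (births_value n +
    ((1 - pd) * \sum_(p <- points a) harvest n (logistic 1 p.2) +
     rate * mean_harvest n))))%:E)%E.
Proof.
move=> C0 e0.
transitivity (\int[transition a]_y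
    ((C + e * (c * births_value n)) +
      (e * c) * \sum_(p <- points y) harvest n p.2)%:E)%E.
  congr (integral _ _ _); apply/funext => y; congr EFin; rewrite /value; ring.
rewrite (@integral_transition _ _ _ _ _ _ _ _ K_gt0 nuK beta_ge0 pd_ge0 pd_le1
  _ (mean_harvest n))//.
- congr EFin; ring.
- exact: continuous_harvest.
- exact: mean_harvestE.
- by rewrite addr_ge0// !mulr_ge0// births_value_ge0.
- by rewrite mulr_ge0.
Qed.

End optimal_harvest.

(** * Comparison with all policies *)

Section optimality.
Context {R : realType}.
Variables (W : set (R * R)) (cW : compact W) (K : R).
Variables (nu : probability (measurableTypeR R) R).
Variables (lambda beta pd c alpha : R).
Hypothesis K_gt0 : 0 < K.
Hypothesis nuK : nu [set` `[0, K]] = 1%E.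
Hypothesis lambda_gt0 : 0 < lambda.
Hypothesis beta_ge0 : 0 <= beta.
Hypothesis pd_ge0 : 0 <= pd.
Hypothesis pd_le1 : pd <= 1.
Hypothesis c_ge0 : 0 <= c.
Hypothesis alpha_ge0 : 0 <= alpha.
Hypothesis alpha_le1 : alpha <= 1.
Local Notation state := (state W K).
Local Notation threshold := (threshold K lambda pd alpha).
Local Notation disc := (discounted_reward c alpha).
Local Notation transition := (transition cW nu lambda beta pd).
Local Notation expectation phi :=
  (expectation_from cW nu lambda beta pd phi (fun h => (disc h)%:E)).
Local Notation V := (@value R W K nu lambda beta pd c alpha).
Local Notation Q := (@action_value R W K nu lambda beta pd c alpha).

Lemma le_integral_transition (a : state) (f g : state -> \bar R) :
  (forall y, 0 <= f y)%E -> (forall y, f y <= g y)%E ->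
  (\int[transition a]_y f y <= \int[transition a]_y g y)%E.
Proof.
move=> f0 fg.
have [mu [muE _]] := @transition_measure R W cW K nu lambda beta pd
  K_gt0 nuK beta_ge0 pd_ge0 pd_le1 a.
by rewrite !(eq_integral_setfun _ muE); exact: ge0_le_integral_raw.
Qed.

Lemma integral_transition_ge0 (a : state) (f : state -> \bar R) :
  (forall y, 0 <= f y)%E -> (0 <= \int[transition a]_y f y)%E.
Proof.
move=> f0.
have [mu [muE _]] := @transition_measure R W cW K nu lambda beta pd
  K_gt0 nuK beta_ge0 pd_ge0 pd_le1 a.
by rewrite (eq_integral_setfun _ muE); exact: integral_ge0.
Qed.

Lemma expectation_ge0 phi n i (h : i.-tuple (state * state)) x :
  (0 <= expectation phi n h x)%E.
Proof.
elim: n i h x => [|n IH] i h x /=; first by rewrite lee_fin disc_ge0.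
by apply: integral_ge0 => a _; apply: integral_transition_ge0 => y; exact: IH.
Qed.

Lemma value_ge0 n x : 0 <= V n x.
Proof.
rewrite mulr_ge0// addr_ge0 ?births_value_ge0// sumr_ge0// => p _.
by have /andP[] := harvest_itv lambda K_gt0 pd_ge0 pd_le1 alpha_ge0 alpha_le1
  n p.2.
Qed.

Lemma integral_transition_step n i (h : i.-tuple (state *
  state)) (x a : state) :
  (\int[transition a]_y (disc (rcons h (x, a)) + alpha ^+ i.+1 * V n y)%:E =
   (disc h + alpha ^+ i * Q n x a)%:E)%E.
Proof.
rewrite integral_transition_value// ?disc_ge0 ?exprn_ge0//.
rewrite disc_rcons /action_value exprSr; congr EFin; ring.
Qed.

(** No measurability of [f] is assumed: it is dominated by the measurable function equal to [v] on
    [A] and to infinity off [A], whose integral is [v]. *)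
Lemma ge0_integral_cst_ae d (T : measurableType d) (P : {measure set T ->
  \bar R})
    (A : set T) (f : T -> \bar R) (v : R) : measurable A -> P setT = 1%E ->
  P A = 1%E ->
  0 <= v -> (forall a, 0 <= f a)%E -> (forall a, A a -> f a <= v%:E)%E ->
  (\int[P]_a f a <= v%:E)%E.
Proof.
move=> mA PT PA v0 f0 fv.
have mAC := measurableC mA.
pose g a : \bar R := (v%:E + +oo * (\1_(~` A) a)%:E)%E.
have g0 a : (0 <= +oo * (\1_(~` A) a)%:E :> \bar R)%E.
  by rewrite mule_ge0// lee_fin.
have mg : measurable_fun setT (fun a => +oo * (\1_(~` A) a)%:E : \bar R)%E.
  apply: emeasurable_funM; first exact: measurable_cst.
  exact/measurable_EFinP/measurable_indic.
apply: (@le_trans _ _ (\int[P]_a g a)%E).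
  apply: ge0_le_integral_raw => // a.
  rewrite /g indicE; have [aA|nA] := boolP (a \in ~` A).
    by rewrite mule1 addey// leey.
  rewrite mule0 adde0; apply: fv; apply: contrapT => /mem_set; exact/negP.
rewrite ge0_integralD//.
rewrite integral_cst// PT mule1.
rewrite (@ge0_ae_eq_integral _ _ _ P setT _ (cst 0%E))// ?integral0 ?adde0//.
have PAC : P (~` A) = 0%E.
  have PToo : (P setT < +oo)%E by rewrite PT ltry.
  rewrite -setTD measureD ?setTI//.
  by rewrite [X in (X - _)%E]PT [X in (_ - X)%E]PA subee.
exists (~` A); split => //.
by move=> a /= na Aa; apply: na => _; rewrite indicE memNset ?mule0//; apply.
Qed.

(** Induction on the remaining steps, for all histories: an admissible kernel is carried by the
    sub-patterns of [x], where [action_value_le] applies. *)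
Lemma expectation_le_value phi : admissible phi ->
  forall n i (h : i.-tuple (state * state)) x,
  (expectation phi n h x <= (disc h + alpha ^+ i * V n x)%:E)%E.
Proof.
move=> adm; elim=> [|n IH] i h x /=.
  by rewrite /value/= big1// addr0 mulr0 mulr0 addr0.
apply: (ge0_integral_cst_ae (P := phi i (h, x))
  (measurable_sub_states (points x)) (prob_kernel _) (adm i h x)).
- by rewrite addr_ge0 ?disc_ge0// mulr_ge0 ?exprn_ge0// value_ge0.
- by move=> a; apply: integral_transition_ge0 => y; exact: expectation_ge0.
move=> a ax; apply: (@le_trans _ _ (disc h + alpha ^+ i * Q n x a)%:E).
  rewrite -integral_transition_step; apply: le_integral_transition => y.
    exact: expectation_ge0.
  exact: (IH i.+1).
rewrite lee_fin lerD2l ler_wpM2l ?exprn_ge0//.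
exact: action_value_le.
Qed.

(** The constraint on i + n makes the threshold at epoch i that of n remaining steps, for which the
    Bellman inequality is an equality. *)
Lemma expectation_ge_value (phi : policy W K) N :
  (forall i (h : i.-tuple (state * state)) (x : state) (B : set state),
     measurable B -> phi i (h, x) B =
       \d_(french_thinning (threshold (N - i)) x) B) ->
  forall n i (h : i.-tuple (state * state)) x, (i + n)%N = N ->
  ((disc h + alpha ^+ i * V n x)%:E <= expectation phi n h x)%E.
Proof.
move=> phiE; elim=> [|n IH] i h x inN /=.
  by rewrite /value/= big1// addr0 mulr0 mulr0 addr0.
rewrite (eq_integral_setfun _ (phiE i h x)).
have -> : (N - i = n.+1)%N by rewrite -inN addKn.
set a0 := french_thinning _ x.
rewrite -(action_value_french_thinning nu beta c K_gt0 lambda_gt0 pd_le1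
  alpha_ge0 n x) -/a0.
set v := disc h + _.
have v0 : 0 <= v.
  rewrite addr_ge0 ?disc_ge0// mulr_ge0 ?exprn_ge0//.
  by rewrite action_value_french_thinning// value_ge0.
have ma0 := measurable_state1 a0.
(* The integrand is not known to be measurable, so it is not evaluated at [a0] but bounded below by
   [v] times the indicator of that point. *)
have <- : (\int[\d_a0]_a (v * \1_[set a0] a)%:E = v%:E)%E.
  rewrite integral_dirac//; last first.
    by apply/measurable_EFinP; apply: measurable_funM.
  by rewrite diracT mul1e indicE mem_set// mulr1.
apply: ge0_le_integral_raw => a; first by rewrite lee_fin mulr_ge0.
rewrite indicE; have [|_] := boolP (a \in _); last first.
  by rewrite mulr0; apply: integral_transition_ge0 => y; exact: expectation_ge0.
rewrite inE => /= ->; rewrite mulr1 /v -integral_transition_step.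
apply: le_integral_transition => y.
  rewrite lee_fin addr_ge0 ?disc_ge0// mulr_ge0 ?exprn_ge0// value_ge0//.
by apply: (IH i.+1); rewrite addSnnS.
Qed.

Lemma measurable_thinning_decision d i :
  measurable_fun setT
    (fun hx : i.-tuple (state * state) * state => french_thinning d hx.2).
Proof.
exact: (measurableT_comp (measurable_french_thinning d) (@measurable_snd _ _ _
  _)).
Qed.

(** A policy must act at every epoch; from epoch [N] on, truncated subtraction gives threshold 0. *)
Definition thinning_policy (N : nat) : policy W K :=
  fun i => kdirac (measurable_thinning_decision (threshold (N - i)) (i := i)).

Lemma thinning_policy_admissible N : admissible (thinning_policy N).
Proof.
move=> i h x; set a := french_thinning (threshold (N - i)) x.
transitivity (\d_a (sub_states (points x)) : \bar R) => //.
by rewrite diracE mem_set//; exact: french_thinning_sub.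
Qed.

Lemma expected_reward_thinning N x :
  expected_reward cW nu lambda beta pd c alpha (thinning_policy N) N x =
  (V N x)%:E.
Proof.
have disc0 : disc ([tuple] : 0.-tuple (state * state)) + alpha ^+ 0 * V N x =
  V N x.
  by rewrite /discounted_reward big_ord0 add0r mul1r.
apply/eqP; rewrite eq_le -{1 2}disc0; apply/andP; split.
  exact/expectation_le_value/thinning_policy_admissible.
exact: (@expectation_ge_value (thinning_policy N) N).
Qed.

Lemma optimal_rewardE N x :
  optimal_reward cW nu lambda beta pd c alpha N x = (V N x)%:E.
Proof.
apply/eqP; rewrite eq_le; apply/andP; split.
  apply: ge_ereal_sup => _ [phi adm <-].
  have := expectation_le_value adm N ([tuple] : 0.-tuple (state * state)) x.
  by rewrite /discounted_reward big_ord0 add0r mul1r.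
rewrite -expected_reward_thinning; apply: ereal_sup_ubound.
by exists (thinning_policy N) => //; exact: thinning_policy_admissible.
Qed.

End optimality.

Theorem mainTheorem3 (R : realType) (W : set (R * R)) (cW : compact W) (K : R)
    (nu : probability (measurableTypeR R) R) (lambda beta pd c alpha : R)
    (n : nat)
    (K_gt0 : 0 < K) (nuK : nu [set` `[0, K]] = 1%E) (lambda_gt0 : 0 < lambda)
    (beta_gt0 : 0 < beta) (pd_gt0 : 0 < pd) (pd_lt1 : pd < 1) (c_gt0 : 0 < c)
    (alpha_ge0 : 0 <= alpha) (alpha_lt1 : alpha < 1) (n_gt0 : (0 < n)%N) :
  (forall x : state W K,
    optimal_reward cW nu lambda beta pd c alpha n x =
    (c * beta * fine (area W) *
       (\sum_(1 <= k < n) alpha ^+ k *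
          \int[nu]_(m in [set` `[0, K]])
            best_harvest K lambda pd alpha (n - k) m) +
     c * \sum_(p <- points x) best_harvest K lambda pd alpha n p.2)%:E) /\
  (exists phi : policy W K,
    [/\ admissible phi,
        forall i (h : i.-tuple (state W K * state W K)) (x : state W K)
               (B : set (state W K)),
          (i < n)%N -> measurable B ->
          phi i (h, x) B =
            \d_(french_thinning (threshold K lambda pd alpha (n - i)) x) B &
        forall x : state W K,
          expected_reward cW nu lambda beta pd c alpha phi n x =
          optimal_reward cW nu lambda beta pd c alpha n x]).
Proof.
have [beta_ge0 pd_ge0 pd_le1 c_ge0 alpha_le1] :
    [/\ 0 <= beta, 0 <= pd, pd <= 1, 0 <= c & alpha <= 1].
  by split; exact: ltW.
split=> [x|]; last first.
  exists (thinning_policy W K lambda pd alpha n); split=> // [|x].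
    exact: thinning_policy_admissible.
  by rewrite optimal_rewardE// expected_reward_thinning.
rewrite optimal_rewardE//; congr EFin.
rewrite /value births_valueE mulrDr; congr (_ + _ * _); last first.
  rewrite big_seq [RHS]big_seq; apply: eq_bigr => p px.
  by case: n n_gt0 => // n' _; rewrite harvestE// (mark_itv px).
rewrite !mulrA; congr (_ * _); rewrite !big_nat;
  apply: eq_bigr => k /andP[k0 kn].
by rewrite -(subnSK kn) mean_harvest_best.
Qed.
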